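(* For every $t\ge 0$, $$N_{\mathrm{PP}}(t) = \tfrac{1}{4} N_{T_{2,2}}(t) + \tfrac{1}{4} \pm \tfrac{1}{2} = \tfrac{1}{4} N_{T_{1,1}}(4t) + \tfrac{1}{4} \pm \tfrac{1}{2},$$ that is, $N_{T_{2,2}}(t)=N_{T_{1,1}}(4t)$ and $N_{\mathrm{PP}}(t) - \frac14 N_{T_{2,2}}(t) - \frac14\in\{-\frac12,\frac12\}$.
   Context: The projective plane PP is obtained from the square $[0,1]\times[0,1]$ by identifying both pairs of opposite boundary edges with reflections. Functions on PP correspond to functions $u$ on $\mathbb{R}^2$ satisfying $u(1-x,y+1)=u(x,y)$ and $u(x+1,1-y)=u(x,y)$ for all $x,y$; such functions have period $2$ in each variable. The Laplacian on PP is the standard Laplacian $-\left(\partial_x^2+\partial_y^2\right)$ (sign chosen so that eigenvalues are nonnegative) acting on such smooth functions on $\mathbb{R}^2$. $N_{\mathrm{PP}}(t)$ is its eigenvalue counting function: the number of eigenvalues $\le t$, counted with multiplicity. For $a>0$, $N_{T_{a,a}}(t)$ is the eigenvalue counting function (with multiplicity) of the Laplacian on the flat torus $[0,a]\times[0,a]$ with opposite sides identified directly; explicitly, $N_{T_{a,a}}(t)=\#\{(j,k)\in\mathbb{Z}^2 : (2\pi)^2((j/a)^2+(k/a)^2)\le t\}$. *)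

(* Defs.v *)
From HB Require Import structures.
From mathcomp Require Import all_boot all_order all_algebra.
From mathcomp Require Import all_classical all_reals all_analysis.

Set Implicit Arguments.
Unset Strict Implicit.
Unset Printing Implicit Defensive.

Import Order.TTheory GRing.Theory Num.Theory.
Import numFieldNormedType.Exports.

Local Open Scope classical_set_scope.
Local Open Scope ring_scope.

Section Spectrum.
Context {R : realType}.
Implicit Types (u : R * R -> R) (S : set (R * R -> R)) (lam t a : R).

(* Coordinate directions: false is the x-axis, true is the y-axis. *)
Definition axis (b : bool) : R * R := if b then (0, 1) else (1, 0).

(* The head of s is the last derivative taken. *)
Definition iter_partial (s : seq bool) u : R * R -> R :=
  foldr (fun b f p => 'D_(axis b) f p) u s.

(* C^oo: partial derivatives of all orders exist and are continuous. *)
Definition smooth u : Prop :=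
  forall s : seq bool,
    continuous (iter_partial s u) /\
    forall (b : bool) (p : R * R), derivable (iter_partial s u) p (axis b).

Definition laplacian u : R * R -> R := fun p =>
  - (iter_partial [:: false; false] u p + iter_partial [:: true; true] u p).

Definition fun_PP : set (R * R -> R) :=
  [set u | smooth u /\ forall x y : R,
     u (1 - x, y + 1) = u (x, y) /\ u (x + 1, 1 - y) = u (x, y)].

Definition fun_torus a : set (R * R -> R) :=
  [set u | smooth u /\ forall x y : R,
     u (x + a, y) = u (x, y) /\ u (x, y + a) = u (x, y)].

Definition eigenspace_in S lam : set (R * R -> R) :=
  [set u | S u /\ forall p, laplacian u p = lam * u p].

Definition eigenvalue_in S lam : Prop :=
  exists2 u, eigenspace_in S lam u & exists p, u p != 0.

Definition lin_indep (n : nat) (f : 'I_n -> R * R -> R) : Prop :=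
  forall c : 'I_n -> R,
    (forall p, \sum_(i < n) c i * f i p = 0) -> forall i, c i = 0.

(* Dimension of a linear space of functions, +oo if it is infinite: the
   supremum of the sizes of its linearly independent families. *)
Definition fun_dim S : \bar R :=
  ereal_sup [set (n%:R)%:E | n in [set n : nat |
    exists f : 'I_n -> R * R -> R, (forall i, S (f i)) /\ lin_indep f]].

(* Number of eigenvalues <= t, counted with multiplicity.  The value lies in
   \bar R; its finiteness is not built in. *)
Definition counting S t : \bar R :=
  \esum_(lam in [set lam | eigenvalue_in S lam /\ lam <= t])
     fun_dim (eigenspace_in S lam).

Definition N_PP t : \bar R := counting fun_PP t.

Definition N_torus a t : \bar R := counting (fun_torus a) t.

End Spectrum.

(* Main.v *)
Require Import Defs.
From HB Require Import structures.
From mathcomp Require Import all_boot all_order all_algebra.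
From mathcomp Require Import all_classical all_reals all_analysis.
From mathcomp Require Import zify ring lra.

Import Order.TTheory GRing.Theory Num.Theory.
Import numFieldNormedType.Exports.

Local Open Scope classical_set_scope.
Local Open Scope ring_scope.

Set Implicit Arguments.
Unset Strict Implicit.
Unset Printing Implicit Defensive.

(** On the torus of side a the products of a cosine or sine of 2 pi m x / a
    with a cosine or sine of 2 pi n y / a are eigenfunctions with eigenvalue
    (2 pi / a)^2 (m^2 + n^2), and each glide reflection of the square of side 1
    multiplies such a product of side 2 by a sign.  Once these products are
    known to span all eigenfunctions, N_PP counts the products with both signs
    equal to 1, and the theorem is a count of lattice points: an open quadrant
    of frequencies contributes to N_PP exactly a quarter of what it contributes
    to the torus, whatever the parities, so the discrepancy comes from the axes
    only.  There, 4 N_PP - N_T is 3 from the frequency (0, 0) plus four times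
    the sum of (-1)^m over the m > 0 with (pi m)^2 <= t, and that
    alternating sum is 0 or -1 ([projective_count]).

    Completeness of the products ([eigenfunction_modes]) is proved without
    integration, from three facts.
    - An eigenfunction u with eigenvalue at most t and |u| <= M satisfies
      |du/dx| <= M (t + 2).  Indeed (du/dx)^2 + (t + 1) u^2 attains a maximum
      on the torus and its Laplacian is nonpositive there ([gradient_bound]).
      As du/dx is an eigenfunction again, the n-th derivative of u along a line
      is at most M (t + 2)^n.
    - A periodic function g of one variable with |g^(n)| <= M C^n is a
      trigonometric polynomial, whose coefficients are means over a single
      finite grid ([sampling_formula]).  The coefficient of frequency m over a
      grid of N points is multiplied by 4 sin^2 (pi m / N), up to sign, when g
      is replaced by its second difference, whereas k-fold second differences
      are at most M (a C / N)^(2 k); so it vanishes for a C < m <= N / 2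
      ([grid_mean_high_freq]).  Aliasing then shows that the low coefficients
      do not change when the grid is refined, and the resulting polynomial
      agrees with g on a dense set.
    - The sampling formula along horizontal lines, followed by the one along
      vertical lines, writes u as a finite combination of products
      ([eigenfunction_expansion]).  Linear independence of the products and the
      equation for u leave only those of the right eigenvalue. *)

(** * Second differences *)

Section OneVariable.
Context {R : realType}.
Implicit Types (f g F : R -> R) (a h x y w : R) (N m r d : nat).

Lemma mean_value_step f f' x h : 0 < h ->
  (forall y, is_derive y 1 f (f' y)) ->
  exists2 c, x < c < x + h & f (x + h) - f x = h * f' c.
Proof.
move=> h0 df.
have cf : {within `[x, x + h], continuous f}.
  apply: derivable_within_continuous => y _.
  exact: (@ex_derive _ _ _ _ _ _ _ (df y)).
have xh : x < x + h by rewrite ltrDl.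
have [c cI E] := MVT xh (fun y _ => df y) cf.
exists c; first by move: cI; rewrite in_itv.
by rewrite E addrC addKr mulrC.
Qed.

Lemma is_derive_translate f (f' : R) x h :
  is_derive (x + h) 1 f f' -> is_derive x 1 (fun y => f (y + h)) f'.
Proof.
move=> H; rewrite -[f']mulr1.
apply: (@is_derive1_comp R f (fun y => y + h)); exact: is_derive_shift x 1 h.
Qed.

Definition second_difference h f x := f (x + h) + f (x - h) - 2 * f x.

Lemma second_difference_mean_value f f1 f2 x h : 0 < h ->
  (forall y, is_derive y 1 f (f1 y)) -> (forall y, is_derive y 1 f1 (f2 y)) ->
  exists2 c, x - h < c < x + h & second_difference h f x = h ^+ 2 * f2 c.
Proof.
move=> h0 df df1.
have dq y : is_derive y 1 (fun y => f (y + h) - f y) (f1 (y + h) - f1 y).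
  by apply: is_deriveB; exact: is_derive_translate.
have [c /andP[c1 c2] Ec] :=
  @mean_value_step (fun y => f (y + h) - f y) _ (x - h) h h0 dq.
have [e /andP[e1 e2] Ee] := @mean_value_step f1 _ c h h0 df1.
exists e; first by lra.
move: Ec; rewrite subrK Ee /second_difference => Ec; rewrite expr2 -mulrA -Ec.
ring.
Qed.

(** [G] lists a function and its successive derivatives; the growth of the
    bounds is that of a function of exponential type [C]. *)
Definition bounded_tower (C M : R) (G : nat -> R -> R) : Prop :=
  forall n x, is_derive x 1 (G n) (G n.+1 x) /\ `|G n x| <= M * C ^+ n.

(** A second difference of step h costs two derivatives and gains h^2, so it
    stays of exponential type C while its bound is multiplied by (h C)^2. *)
Lemma bounded_tower_second_difference C M G h : 0 < h ->
  bounded_tower C M G ->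
  bounded_tower C (M * (h * C) ^+ 2) (fun n => second_difference h (G n)).
Proof.
move=> h0 tG n x; split.
  rewrite /second_difference; apply: is_deriveB.
    apply: is_deriveD; apply: is_derive_translate; exact: (tG _ _).1.
  by apply: is_deriveZ; exact: (tG _ _).1.
have [c _ ->] := @second_difference_mean_value (G n) (G n.+1) (G n.+2) x h h0
  (fun y => (tG n y).1) (fun y => (tG n.+1 y).1).
rewrite normrM ger0_norm ?(exprn_ge0 _ (ltW h0))//.
have -> : M * (h * C) ^+ 2 * C ^+ n = h ^+ 2 * (M * C ^+ n.+2).
  by rewrite !exprS expr0; ring.
by apply: ler_wpM2l; [exact/exprn_ge0/ltW|exact: (tG _ _).2].
Qed.

Lemma bounded_tower_iter_second_difference C M G h k : 0 < h ->
  bounded_tower C M G -> forall x,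
  `|iter k (second_difference h) (G 0) x| <= M * (h * C) ^+ k.*2.
Proof.
move=> h0; elim: k M G => [|k IH] M G tG x.
  by have [_] := tG 0 x; rewrite double0 !expr0.
rewrite iterSr (le_trans (IH _ _ (@bounded_tower_second_difference C M G h h0 tG) x))//.
by rewrite doubleS -mulrA -exprD add2n.
Qed.

End OneVariable.

(** * Means over a uniform grid *)

Section GridMeans.
Context {R : realType}.
Implicit Types (g F : R -> R) (a h x y : R) (b : bool) (N L m k i : nat).

Definition freq a m : R := 2 * pi / a * m%:R.

Definition mode a b m x : R :=
  if b then sin (freq a m * x) else cos (freq a m * x).

(** The number of integers of absolute value [m], that is the coefficient of
    cos (m x) in the Dirichlet kernel. *)
Definition dirichlet_weight m : R := if m is 0 then 1 else 2.

Definition grid_mean a N F : R := N%:R^-1 * \sum_(i < N) F (a * i%:R / N%:R).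

Lemma freqE a m : freq a m = m%:R * freq a 1.
Proof. by rewrite /freq mulr1 mulrC. Qed.

Lemma mode_periodic a b m : 0 < a -> periodic (mode a b m) a.
Proof.
move=> a0 x; have E : freq a m * (x + a) = freq a m * x + (pi *+ 2) *+ m.
  by rewrite /freq -(mulr_natr _ m) -(mulr_natr pi 2); field; exact: lt0r_neq0.
case: b; rewrite /mode /= E.
  exact: (periodicn (@sinD2pi R)).
exact: (periodicn (@cosD2pi R)).
Qed.

Lemma mode_shift a b m x h :
  mode a b m (x + h) + mode a b m (x - h) =
  2 * cos (freq a m * h) * mode a b m x.
Proof.
rewrite /mode (mulrDr _ x h) (mulrBr _ x h).
by case: b; rewrite ?(sinD, cosD, sinN, cosN); ring.
Qed.

Lemma sum_modeM a m x y :
  \sum_(b : bool) mode a b m x * mode a b m y = cos (m%:R * (freq a 1 * (x - y))).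
Proof.
rewrite big_bool /= !(freqE a m) (_ : _ * (_ * (x - y)) =
  m%:R * freq a 1 * x - m%:R * freq a 1 * y); last by ring.
by rewrite cosB; ring.
Qed.

Lemma norm_mode_le1 a b m x : `|mode a b m x| <= 1.
Proof. by case: b; rewrite /mode ?sin_max ?cos_max. Qed.

Lemma eq_grid_mean a N F F' : F =1 F' -> grid_mean a N F = grid_mean a N F'.
Proof. by move=> E; rewrite /grid_mean; under eq_bigr do rewrite E. Qed.

Lemma grid_meanD a N F F' :
  grid_mean a N (fun x => F x + F' x) = grid_mean a N F + grid_mean a N F'.
Proof. by rewrite /grid_mean big_split mulrDr. Qed.

Lemma grid_meanZ a N (c : R) F :
  grid_mean a N (fun x => c * F x) = c * grid_mean a N F.
Proof. by rewrite /grid_mean -mulr_sumr mulrCA. Qed.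

Lemma grid_mean_sum a N (I : Type) (s : seq I) (F : I -> R -> R) :
  grid_mean a N (fun x => \sum_(j <- s) F j x) = \sum_(j <- s) grid_mean a N (F j).
Proof. by rewrite /grid_mean exchange_big mulr_sumr. Qed.

Lemma norm_grid_mean_le a N F (B : R) :
  (0 < N)%N -> (forall x, `|F x| <= B) -> `|grid_mean a N F| <= B.
Proof.
move=> N0 FB; rewrite /grid_mean normrM normfV normr_nat.
rewrite ler_pdivrMl ?ltr0n//.
apply: (le_trans (ler_norm_sum _ _ _)).
apply: (@le_trans _ _ (\sum_(i < N) B)); first by apply: ler_sum => i _; exact: FB.
by rewrite sumr_const card_ord mulr_natl.
Qed.

Lemma grid_mean_shift a N F : (0 < N)%N -> periodic F a ->
  grid_mean a N (fun x => F (x + a / N%:R)) = grid_mean a N F.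
Proof.
move=> N0 pF; rewrite /grid_mean; congr (_ * _).
under eq_bigr => i _ do rewrite -mulrDl -[X in _ + X]mulr1 -mulrDr natr1.
case: N N0 => // n _.
have Fa : F a = F 0 by rewrite -[a in LHS]add0r pF.
by rewrite big_ord_recr big_ord_recl /= mulfK ?pnatr_eq0// mulr0 mul0r Fa addrC.
Qed.

(** Summation by parts: second differences of step a / N act symmetrically on
    the grid of N points, and every mode is an eigenvector for them. *)
Lemma grid_mean_second_difference a N b m g : 0 < a -> (0 < N)%N -> periodic g a ->
  grid_mean a N (fun x => mode a b m x * second_difference (a / N%:R) g x) =
  (2 * cos (freq a m * (a / N%:R)) - 2) *
    grid_mean a N (fun x => mode a b m x * g x).
Proof.
move=> a0 N0 pg; set h := a / N%:R; set f := mode a b m.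
have pf : periodic f a by move=> x; rewrite /f mode_periodic.
have pl : grid_mean a N (fun x => f x * g (x + h)) =
          grid_mean a N (fun x => f (x - h) * g x).
  rewrite -(@grid_mean_shift a N (fun x => f (x - h) * g x))// => [|x].
    by apply: eq_grid_mean => x; rewrite addrK.
  by rewrite pg addrAC pf.
have pr : grid_mean a N (fun x => f x * g (x - h)) =
          grid_mean a N (fun x => f (x + h) * g x).
  rewrite -(@grid_mean_shift a N (fun x => f x * g (x - h)))// => [|x].
    by apply: eq_grid_mean => x; rewrite addrK.
  by rewrite pf addrAC pg.
rewrite (@eq_grid_mean _ _ _ (fun x => f x * g (x + h) + f x * g (x - h)
  + (- 2) * (f x * g x))); last first.
  by move=> x; rewrite /second_difference; ring.
rewrite !grid_meanD pl pr grid_meanZ -grid_meanD mulrBl mulNr; congr (_ - _).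
rewrite -grid_meanZ; apply: eq_grid_mean => x.
by rewrite mulrA -mode_shift -mulrDl [X in X * _]addrC.
Qed.

Lemma second_difference_periodic a h g : periodic g a ->
  periodic (second_difference h g) a.
Proof.
by move=> pg x; rewrite /second_difference ![x + a + _]addrAC !pg.
Qed.

Lemma iter_second_difference_periodic a h g k : periodic g a ->
  periodic (iter k (second_difference h) g) a.
Proof.
by move=> pg; elim: k => // k IH; exact: second_difference_periodic.
Qed.

Lemma grid_mean_iter_second_difference a N b m g k :
  0 < a -> (0 < N)%N -> periodic g a ->
  grid_mean a N (fun x => mode a b m x *
                          iter k (second_difference (a / N%:R)) g x) =
  (2 * cos (freq a m * (a / N%:R)) - 2) ^+ k *
    grid_mean a N (fun x => mode a b m x * g x).
Proof.
move=> a0 N0 pg; elim: k => [|k IH]; first by rewrite mul1r.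
rewrite exprS -mulrA -IH -grid_mean_second_difference//.
exact: iter_second_difference_periodic.
Qed.

Lemma geometric_domination_eq0 (q p M c : R) : 0 <= p < q -> 0 <= c ->
  (forall k, q ^+ k * c <= M * p ^+ k) -> c = 0.
Proof.
move=> /andP[p0 pq] c0 H; have q0 : 0 < q by exact: le_lt_trans pq.
have s1 : `|p / q| < 1.
  by rewrite ger0_norm ?divr_ge0 ?(ltW q0)// ltr_pdivrMr// mul1r.
have H' k : c <= M * (p / q) ^+ k.
  by rewrite expr_div_n mulrA ler_pdivlMr ?exprn_gt0// mulrC.
have cv : geometric M (p / q) @ \oo --> (0 : R) by exact: cvg_geometric.
apply/eqP; rewrite eq_le c0 andbT.
by apply: (cvgr_to_ge cv); exact: nearW.
Qed.

(** The derivative x sin x of sin x - x cos x is nonnegative, and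
    sin x = 2 sin (x / 2) cos (x / 2) >= x cos^2 (x / 2) = x (1 + cos x) / 2. *)
Lemma sin_ge_half x : 0 <= x <= pi / 2 -> x / 2 <= sin x.
Proof.
have xcos y : 0 <= y <= pi / 2 -> y * cos y <= sin y.
  move=> /andP[y0 y1]; rewrite -subr_ge0.
  pose f : R -> R := fun z => sin z - z * cos z.
  have df (z : R) : is_derive z 1 f (z * sin z).
    have -> : z * sin z = cos z - (z *: (- sin z) + cos z *: (1 : R)).
      by rewrite /GRing.scale /=; ring.
    exact: (@is_deriveB _ _ _ _ _ _ _ _ _ (is_derive_sin z)
      (is_deriveM (is_derive_id z (1 : R)) (is_derive_cos z))).
  have [->|yp] := eqVneq y 0; first by rewrite mul0r sin0 subrr.
  have {}y0 : 0 < y by rewrite lt0r yp y0.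
  have [c /andP[c0 cy] E] := @mean_value_step _ f _ 0 y y0 df.
  have : f y = y * (c * sin c).
    by rewrite -E add0r /f sin0 mul0r !subr0.
  rewrite /f => ->; rewrite !mulr_ge0 ?(ltW y0) ?(ltW c0)//.
  apply: sin_ge0_pi; move: c0 cy y1 (@pi_ge0 R); rewrite add0r; lra.
move=> /andP[x0 x1].
have xh : x = (x / 2) *+ 2 by rewrite -mulr_natr divfK ?pnatr_eq0.
rewrite {2}xh sin_mulr2n.
have h0 : 0 <= x / 2 <= pi / 2 by move: x0 x1; lra.
have c0 : 0 <= cos (x / 2) by apply: cos_ge0_pihalf; move: h0; lra.
have cx : 0 <= cos x by apply: cos_ge0_pihalf; move: x0 x1; lra.
have := ler_wpM2l c0 (xcos _ h0).
move: cx; rewrite {1}xh cos_mulr2n => cx ineq.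
have : x / 2 * (2^-1 *+ 2) <= x / 2 * (cos (x / 2) ^+ 2 *+ 2).
  by apply: ler_wpM2l; lra.
lra.
Qed.

End GridMeans.

(** * The interpolation formula of grid means *)

Section Sampling.
Context {R : realType}.
Implicit Types (g F : R -> R) (a h x y : R) (b : bool) (N L m k i d j : nat).

Lemma freq_step a N m : 0 < a -> freq a m * (a / N%:R) = 2 * (pi * m%:R / N%:R).
Proof.
move=> a0; rewrite /freq -!mulrA; congr (_ * (_ * _)).
by rewrite mulrCA mulKf ?lt0r_neq0.
Qed.

Lemma two_sub_two_cos x : 2 - 2 * cos (2 * x) = 4 * sin x ^+ 2.
Proof. by rewrite (mulr_natl x 2) cos_mulr2n sin2cos2; ring. Qed.

(** Taking k second differences multiplies this mean by (4 sin^2 phi)^k up to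
    sign, with phi = pi m / N, but makes the function smaller than M (h C)^(2 k)
    with h = a / N.  As phi <= pi / 2, 2 sin phi >= phi = pi m / N > h C, and
    the two rates are compatible only if the mean is 0. *)
Lemma grid_mean_high_freq a N b m (C M : R) (G : nat -> R -> R) :
  0 < a -> 0 <= C -> bounded_tower C M G -> periodic (G 0) a ->
  a * C < m%:R -> (m.*2 <= N)%N ->
  grid_mean a N (fun x => mode a b m x * G 0 x) = 0.
Proof.
move=> a0 C0 tG pG Cm mN.
have m0 : 0 < m%:R :> R by apply: le_lt_trans Cm; rewrite mulr_ge0// ltW.
have N0 : (0 < N)%N by move: m0 mN; rewrite ltr0n; lia.
have NR : 0 < N%:R :> R by rewrite ltr0n.
set h := a / N%:R; have h0 : 0 < h by rewrite divr_gt0.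
set c := grid_mean _ _ _.
pose phi : R := pi * m%:R / N%:R.
have phi0 : 0 <= phi <= pi / 2.
  rewrite /phi !divr_ge0 ?mulr_ge0 ?pi_ge0 ?ler0n//= ler_pdivrMr// mulrAC -mulrA.
  rewrite ler_pM2l ?pi_gt0// ler_pdivlMr// -natrM ler_nat; lia.
have phi_ge0 : 0 <= phi by case/andP: phi0.
have lt : (h * C) ^+ 2 < 4 * sin phi ^+ 2.
  apply: (@lt_le_trans _ _ (4 * (phi / 2) ^+ 2)); last first.
    have half := sin_ge_half phi0; have half0 : 0 <= phi / 2 by rewrite divr_ge0.
    by rewrite ler_pM2l// ler_pXn2r// nnegrE// (le_trans half0).
  have -> : 4 * (phi / 2) ^+ 2 = phi ^+ 2 by field.
  rewrite ltr_pXn2r// ?nnegrE ?(mulr_ge0 (ltW h0) C0)//.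
  rewrite /h /phi mulrAC ltr_pM2r ?invr_gt0// (lt_le_trans Cm)//.
  by rewrite ler_peMl ?ler0n// (le_trans _ (@pi_ge2 R))// ler1n.
apply: normr0_eq0.
apply: (@geometric_domination_eq0 _ (4 * sin phi ^+ 2) ((h * C) ^+ 2) M) => //.
  by rewrite lt andbT exprn_ge0// mulr_ge0// ltW.
have E : 2 - 2 * cos (freq a m * h) = 4 * sin phi ^+ 2.
  by rewrite freq_step// two_sub_two_cos.
have q0 : 0 <= 4 * sin phi ^+ 2 by rewrite mulr_ge0// exprn_even_ge0.
move=> k; have -> : (4 * sin phi ^+ 2) ^+ k * `|c| =
    `|(2 * cos (freq a m * h) - 2) ^+ k * c|.
  by rewrite [RHS]normrM normrX distrC E (ger0_norm q0).
rewrite -grid_mean_iter_second_difference// -exprM mul2n.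
apply: norm_grid_mean_le => // x; rewrite normrM -[leRHS]mul1r.
apply: ler_pM => //; first exact: norm_mode_le1.
exact: (bounded_tower_iter_second_difference _ h0 tG).
Qed.

Lemma dirichlet_kernel L y :
  sin (y / 2) * \sum_(m < L.+1) dirichlet_weight m * cos (m%:R * y) =
  sin (L%:R * y + y / 2).
Proof.
elim: L => [|L IH].
  by rewrite big_ord1 /= !mul0r cos0 add0r !mulr1.
rewrite big_ord_recr /= mulrDr IH.
have -> : L%:R * y + y / 2 = L.+1%:R * y - y / 2 by rewrite -natr1; field.
by rewrite sinB sinD; ring.
Qed.

Lemma sin_nat_pi m : sin (pi * m%:R) = 0 :> R.
Proof. by rewrite mulr_natr -[_ *+ m]add0r (alternatingn (@sinDpi R)) sin0 mulr0. Qed.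

Lemma dirichlet_kernel_eq0 L d : (0 < d < L.*2.+1)%N ->
  \sum_(m < L.+1) dirichlet_weight m *
      cos (m%:R * (2 * (pi * d%:R / L.*2.+1%:R))) = 0 :> R.
Proof.
move=> /andP[d0 dN]; set y := 2 * _.
have y2 : y / 2 = pi * d%:R / L.*2.+1%:R by rewrite /y mulrAC divff ?mul1r.
have s0 : sin (y / 2) != 0.
  apply/lt0r_neq0/sin_gt0_pi; rewrite y2 divr_gt0 ?mulr_gt0 ?pi_gt0 ?ltr0n//=.
  by rewrite ltr_pdivrMr ?ltr0n// ltr_pM2l ?pi_gt0// ltr_nat.
apply: (mulfI s0); rewrite dirichlet_kernel mulr0.
have -> : L%:R * y + y / 2 = pi * d%:R.
  rewrite (_ : L%:R * y + y / 2 = L.*2.+1%:R * (y / 2)); last first.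
    by rewrite -(natr1 L.*2) -(mul2n L) natrM; field.
  by rewrite y2 mulrC divfK// pnatr_eq0.
exact: sin_nat_pi.
Qed.

Lemma dirichlet_kernel0 L :
  \sum_(m < L.+1) dirichlet_weight m = L.*2.+1%:R :> R.
Proof.
elim: L => [|L IH]; first by rewrite big_ord1.
by rewrite big_ord_recr /= IH doubleS -natrD addn2.
Qed.

Lemma dirichlet_kernel_grid L i j : (i < L.*2.+1)%N -> (j < L.*2.+1)%N ->
  \sum_(m < L.+1) dirichlet_weight m *
     cos (m%:R * (2 * (pi * (i%:R - j%:R) / L.*2.+1%:R))) =
  (if i == j then L.*2.+1%:R else 0) :> R.
Proof.
move=> iN jN; have [->|ij] := eqVneq i j.
  rewrite subrr mulr0 mul0r mulr0 -dirichlet_kernel0.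
  by apply: eq_bigr => m _; rewrite mulr0 cos0 mulr1.
wlog lt : i j iN jN ij / (j < i)%N.
  move=> H; move: (ij); rewrite neq_ltn => /orP[lt|]; last exact: H.
  rewrite -[RHS](H j i)// 1?eq_sym//; apply: eq_bigr => m _; congr (_ * _).
  by rewrite -cosN; congr cos; rewrite -opprB; ring.
rewrite -natrB ?(ltnW lt)//; apply: dirichlet_kernel_eq0.
by rewrite subn_gt0 lt/= (leq_ltn_trans _ iN)// leq_subr.
Qed.

(** Discrete Fourier inversion on a grid with an odd number of points: summing
    the modes against each other gives the Dirichlet kernel, which vanishes at
    every grid point but the origin. *)
Lemma grid_inversion a L i g : 0 < a -> (i < L.*2.+1)%N ->
  let N := L.*2.+1 in let x := a * i%:R / N%:R in
  g x = \sum_(m < L.+1) \sum_(b : bool) dirichlet_weight m *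
      mode a b m x * grid_mean a N (fun y => mode a b m y * g y).
Proof.
move=> a0 iN N x.
transitivity (grid_mean a N (fun y => (\sum_(m < L.+1) dirichlet_weight m *
     cos (m%:R * (freq a 1 * (x - y)))) * g y)); last first.
  rewrite (@eq_grid_mean _ _ _ _ (fun y => \sum_(m < L.+1) \sum_(b : bool)
    (dirichlet_weight m * mode a b m x) * (mode a b m y * g y))).
    rewrite grid_mean_sum; apply: eq_bigr => m _.
    by rewrite grid_mean_sum; apply: eq_bigr => b _; rewrite grid_meanZ.
  move=> y; rewrite mulr_suml; apply: eq_bigr => m _.
  rewrite -sum_modeM mulr_sumr mulr_suml; apply: eq_bigr => b _; ring.
have K (j : 'I_N) : \sum_(m < L.+1) dirichlet_weight m *
    cos (m%:R * (freq a 1 * (x - a * j%:R / N%:R))) =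
    if i == j then N%:R else 0.
  rewrite -dirichlet_kernel_grid//; apply: eq_bigr => m _.
  congr (_ * cos (_ * _)); rewrite /freq mulr1 /x -/N; field.
  by rewrite ?pnatr_eq0 ?(lt0r_neq0 a0).
rewrite /grid_mean; under eq_bigr do rewrite K.
rewrite (bigD1 (Ordinal iN))//= eqxx [X in _ + X]big1 => [|j ji].
  by rewrite addr0 mulKf// pnatr_eq0.
by rewrite eq_sym (negbTE (ji : nat_of_ord j != i)) mul0r.
Qed.

Lemma sum_mul3 N (H : nat -> R) :
  \sum_(i < 3 * N) H i = \sum_(i < N) (H (3 * i)%N + H (3 * i).+1 + H (3 * i).+2).
Proof.
elim: N => [|N IH]; first by rewrite muln0 !big_ord0.
by rewrite mulnSr addn3 !big_ord_recr /= IH -!addrA.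
Qed.

Lemma cos_third_mod m i : 1 + 2 * cos (2 * (pi * (3 * i + m)%N%:R / 3%:R)) =
  1 + 2 * cos (2 * (pi * m%:R / 3%:R)) :> R.
Proof.
congr (_ + _ * _); rewrite -[RHS](periodicn (@cosD2pi R) i); congr cos.
by rewrite natrD natrM -(mulr_natr _ i) -(mulr_natr pi 2); field.
Qed.

(** On the grid of 3 N points the factor 1 + 2 cos (2 pi N x / a) is 3 on the
    points of the coarse grid and 0 on the others. *)
Lemma grid_mean_refine a N F : 0 < a -> (0 < N)%N ->
  grid_mean a N F =
  grid_mean a (3 * N) (fun x => (1 + 2 * mode a false N x) * F x).
Proof.
move=> a0 N0.
have E i : mode a false N (a * i%:R / (3 * N)%N%:R) = cos (2 * (pi * i%:R / 3%:R)).
  rewrite /mode /freq natrM; congr cos; field.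
  by rewrite ?(lt0r_neq0 a0) ?pnatr_eq0 -?lt0n ?N0.
rewrite /grid_mean.
rewrite (@sum_mul3 N (fun i => (1 + 2 * mode a false N (a * i%:R / (3 * N)%N%:R)) *
   F (a * i%:R / (3 * N)%N%:R))).
have k m : (0 < m < 3)%N -> 1 + 2 * cos (2 * (pi * m%:R / 3%:R)) = 0 :> R.
  move=> m3; have := @dirichlet_kernel_eq0 1 m m3.
  by rewrite !big_ord_recr big_ord0 /= add0r mul0r cos0 !mul1r.
have k0 i : 1 + 2 * cos (2 * (pi * (3 * i)%N%:R / 3%:R)) = 3 :> R.
  rewrite -[(3 * i)%N]addn0. by rewrite (cos_third_mod 0 i) mulr0 mul0r mulr0 cos0; ring.
have k1 i : 1 + 2 * cos (2 * (pi * (3 * i)%N.+1%:R / 3%:R)) = 0 :> R.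
  by rewrite -(addn1 (3 * i)) (cos_third_mod 1 i) k.
have k2 i : 1 + 2 * cos (2 * (pi * (3 * i)%N.+2%:R / 3%:R)) = 0 :> R.
  by rewrite -(addn2 (3 * i)) (cos_third_mod 2 i) k.
under [in RHS]eq_bigr => i _.
  rewrite !E k0 k1 k2 !mul0r !addr0.
  rewrite (_ : a * (3 * i)%N%:R / (3 * N)%N%:R = a * i%:R / N%:R); last first.
    by rewrite !natrM; field; rewrite ?pnatr_eq0 -?lt0n ?N0.
  over.
rewrite -mulr_sumr mulrA; congr (_ * _); rewrite natrM; field.
by rewrite ?pnatr_eq0 -?lt0n ?N0.
Qed.

End Sampling.

(** * Sampling of periodic functions of exponential type *)

Section SamplingTheorem.
Context {R : realType}.
Implicit Types (g F : R -> R) (a h x y : R) (b : bool) (N L m k i : nat).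

Lemma continuous_mode a b m : continuous (mode a b m).
Proof.
move=> x; have cl : {for x, continuous (fun y : R => freq a m * y)}.
  by apply: cvgM; [exact: cvg_cst|exact: cvg_id].
case: b; rewrite /mode.
  by apply: continuous_comp; [exact: cl|exact: continuous_sin].
by apply: continuous_comp; [exact: cl|exact: continuous_cos].
Qed.

(** The representative is the same for all functions of period [a], which makes
    it possible to compare two of them. *)
Lemma periodic_shift_to a x : 0 < a ->
  exists2 y, 0 <= y < a & forall F, periodic F a -> F y = F x.
Proof.
move=> a0.
have pos y : 0 <= y -> exists2 z, 0 <= z < a & forall F, periodic F a -> F z = F y.
  move=> y0; have ya : 0 <= y / a by rewrite divr_ge0// ltW.
  set q := Num.truncn (y / a); have /andP[qy yq] := truncn_itv ya.
  exists (y - a *+ q) => [|F pF]; last by rewrite -(periodicn pF q) subrK.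
  rewrite -mulr_natl subr_ge0 -ler_pdivlMr// qy/=.
  by rewrite ltrBlDl -{2}[a]mul1r -mulrDl natr1 -ltr_pdivrMr.
pose n := Num.bound `|x / a|.
have : `|x / a| < n%:R by exact: archi_boundP (normr_ge0 _).
rewrite ltr_norml => /andP[+ _].
rewrite ltr_pdivlMr// mulNr mulr_natl => nx.
have [|z zI Fz] := pos (x + a *+ n); first by move: nx; lra.
by exists z => // F pF; rewrite Fz// periodicn.
Qed.

Lemma mode_aliasing a b m N x : (m <= N)%N ->
  2 * mode a false N x * mode a b m x =
  mode a b (N + m) x + (-1) ^+ b * mode a b (N - m) x.
Proof.
move=> mN; rewrite /mode !(freqE a (_ + _)) !(freqE a (_ - _)) !(freqE a m) !(freqE a N).
rewrite natrD natrB//.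
have -> : (N%:R + m%:R) * freq a 1 * x = N%:R * freq a 1 * x + m%:R * freq a 1 * x by ring.
have -> : (N%:R - m%:R) * freq a 1 * x = N%:R * freq a 1 * x - m%:R * freq a 1 * x by ring.
by case: b; rewrite ?(sinD, cosD, sinN, cosN) /=; ring.
Qed.

Section Tower.
Variables (a C M : R) (G : nat -> R -> R) (L : nat).
Hypotheses (a0 : 0 < a) (C0 : 0 <= C) (tG : bounded_tower C M G)
  (pG : periodic (G 0) a) (aCL : a * C < L.+1%:R).

(* The coefficient of the mode (b, m), up to its weight, on a grid of N points. *)
Let c N b m := grid_mean a N (fun x => mode a b m x * G 0 x).

Let high N b m : (L < m)%N -> (m.*2 <= N)%N -> c N b m = 0.
Proof.
move=> Lm mN; apply: (@grid_mean_high_freq _ a N b m C M) => //.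
by apply: lt_le_trans aCL _; rewrite ler_nat.
Qed.

(* Tripling the grid adds to the coefficient of frequency m only those of the
   frequencies N + m and N - m, which are high enough to vanish. *)
Let refine N b m : (m <= L)%N -> (L.*2 < N)%N -> c (3 * N) b m = c N b m.
Proof.
move=> mL LN; rewrite /c [RHS](@grid_mean_refine _ a N)//; last by lia.
rewrite [RHS](@eq_grid_mean _ _ _ _ (fun x => mode a b m x * G 0 x +
   (mode a b (N + m) x * G 0 x + (-1) ^+ b * (mode a b (N - m) x * G 0 x)))).
  by rewrite !grid_meanD grid_meanZ -!/(c _ _ _) (@high _ b (N + m)) ?(@high _ b (N - m)) ?mulr0 ?addr0//; lia.
move=> x; rewrite mulrA mulrDl mul1r mode_aliasing; last by lia.
ring.
Qed.

Let interp x := \sum_(m < L.+1) \sum_(b : bool)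
  dirichlet_weight m * mode a b m x * c L.*2.+1 b m.

(* Multiplying by 3 keeps the number of grid points odd, as the inversion
   formula requires, and the grids become dense. *)
Let NL k := (3 ^ k * L.*2.+1)%N.

Let NL_odd k : exists2 K, NL k = K.*2.+1 & (L <= K)%N.
Proof.
rewrite /NL; elim: k => [|k [K E LK]]; first by exists L; rewrite ?mul1n.
by exists (3 * K).+1; [rewrite expnS -mulnA E; lia|lia].
Qed.

Let coef_stable k b m : (m <= L)%N -> c (NL k) b m = c L.*2.+1 b m.
Proof.
move=> mL; elim: k => [|k IH]; first by rewrite /NL mul1n.
rewrite -IH /NL expnS -mulnA refine//.
have [K E LK] := NL_odd k; rewrite /NL in E; rewrite E; lia.
Qed.

Let interp_grid k i : (i < NL k)%N ->
  G 0 (a * i%:R / (NL k)%:R) = interp (a * i%:R / (NL k)%:R).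
Proof.
have [K E LK] := NL_odd k => iN.
rewrite [LHS](_ : _ = \sum_(m < K.+1) \sum_(b : bool) dirichlet_weight m *
    mode a b m (a * i%:R / (NL k)%:R) * c (NL k) b m); last first.
  by move: iN; rewrite /c E => iN; exact: grid_inversion.
rewrite -(big_mkord xpredT (fun m => \sum_(b : bool) dirichlet_weight m *
    mode a b m (a * i%:R / (NL k)%:R) * c (NL k) b m)).
rewrite (@big_cat_nat _ _ _ L.+1)//= [X in _ + X]big1_seq ?addr0; last first.
  move=> m /=; rewrite mem_index_iota => /andP[Lm mK].
  by rewrite big1// => b _; rewrite high ?mulr0// E; lia.
rewrite big_mkord; apply: eq_bigr => m _; apply: eq_bigr => b _.
by rewrite coef_stable// -ltnS.
Qed.

Let continuous_interp : continuous interp.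
Proof.
apply: continuous_big => [|m _]; first exact: add_continuous.
apply: continuous_big => [|b _]; first exact: add_continuous.
move=> x; apply: cvgM; last exact: cvg_cst.
by apply: cvgM; [exact: cvg_cst|exact: continuous_mode].
Qed.

Let interp_periodic : periodic interp a.
Proof.
move=> x; apply: eq_bigr => m _; apply: eq_bigr => b _.
by rewrite mode_periodic.
Qed.

Let continuous_G : continuous (G 0).
Proof.
move=> x; apply/differentiable_continuous/derivable1_diffP.
exact: (@ex_derive _ _ _ _ _ _ _ (tG 0 x).1).
Qed.

Let interp_period x : 0 <= x < a -> G 0 x = interp x.
Proof.
move=> /andP[x0 xa]; apply/eqP; rewrite -subr_eq0; apply/negP => /negP d0.
have cd : {for x, continuous (fun y => G 0 y - interp y)}.
  by apply: cvgB; [exact: continuous_G|exact: continuous_interp].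
have /nbhs_ballP[e /= e0 He] : \forall y \near x, G 0 y - interp y != 0.
  exact: (@cvgr_neq0 _ _ _ _ _ _ (G 0 x - interp x) cd d0).
pose k := Num.bound (a / e).
have ek : a / e < (NL k)%:R.
  apply: (lt_le_trans (archi_boundP _)); first by rewrite divr_ge0 ?ltW.
  rewrite ler_nat /NL -/k (leq_trans (ltnW (ltn_expl k (isT : 1 < 3)%N)))//.
  by rewrite leq_pmulr.
have N0 : 0 < (NL k)%:R :> R by apply: le_lt_trans ek; rewrite divr_ge0 ?ltW.
set z := x * (NL k)%:R / a.
have z0 : 0 <= z by rewrite divr_ge0 ?mulr_ge0 ?(ltW a0) ?(ltW N0).
have xz : x = a * z / (NL k)%:R.
  by rewrite /z; field; rewrite !lt0r_neq0.
have /andP[iz zi] := truncn_itv z0.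
have iN : (Num.truncn z < NL k)%N.
  rewrite -(ltr_nat R) (le_lt_trans iz)// ltr_pdivrMr// mulrC ltr_pM2l//.
suff Hb : ball x e (a * (Num.truncn z)%:R / (NL k)%:R).
  by move: (He _ Hb); rewrite (interp_grid iN) subrr eqxx.
have zi0 : 0 <= z - (Num.truncn z)%:R by rewrite subr_ge0.
rewrite /ball /= [X in `|X|](_ : _ = a / (NL k)%:R * (z - (Num.truncn z)%:R)).
  rewrite normrM (gtr0_norm (divr_gt0 a0 N0)) (ger0_norm zi0).
  apply: (@le_lt_trans _ _ (a / (NL k)%:R)).
    by rewrite ler_piMr ?(ltW (divr_gt0 a0 N0))// lerBlDl natr1 ltW.
  by rewrite ltr_pdivrMr// mulrC -ltr_pdivrMr.
by rewrite {1}xz; ring.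
Qed.

(** Inversion on each of the refined grids involves only the frequencies up to
    [L], with coefficients that do not depend on the grid.  Hence the right-hand
    side agrees with [G 0] on a dense set, and both sides are continuous. *)
Lemma sampling_formula x : G 0 x = \sum_(m < L.+1) \sum_(b : bool)
  dirichlet_weight m * mode a b m x *
  grid_mean a L.*2.+1 (fun y => mode a b m y * G 0 y).
Proof.
have [y yI Fy] := periodic_shift_to x a0.
by rewrite -(Fy _ pG) interp_period// (Fy _ interp_periodic).
Qed.

End Tower.
End SamplingTheorem.

(** * Partial derivatives in the plane *)

Section Plane.
Context {R : realType}.
Implicit Types (u v f : R * R -> R) (p q : R * R) (b c : bool) (s : seq bool).

Definition on_line b p (t : R) : R * R := if b then (p.1, t) else (t, p.2).

Definition coordinate b p : R := if b then p.2 else p.1.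

Lemma on_line_coordinate b p : on_line b p (coordinate b p) = p.
Proof. by case: p => x y; case: b. Qed.

(** Reduces partial derivatives to derivatives of functions of one variable. *)
Lemma is_derive_axisE b f p (df : R) :
  is_derive p (axis b) f df <->
  is_derive (coordinate b p) 1 (fun t => f (on_line b p t)) df.
Proof.
have E : (fun h : R => h^-1 *: ((f \o shift p) (h *: axis b) - f p)) =
  (fun h : R => h^-1 *: (((fun t => f (on_line b p t)) \o shift (coordinate b p))
     (h *: (1 : R)) - f (on_line b p (coordinate b p)))).
  apply/funext => h; rewrite on_line_coordinate /shift /=; congr (_ *: (f _ - _)).
  case: p => x y; case: b; rewrite /axis /on_line /coordinate /=.
    by rewrite -[LHS]/(h * 0 + x, h * 1 + y) mulr0 add0r.
  by rewrite -[LHS]/(h * 1 + x, h * 0 + y) mulr0 add0r.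
split=> -[D1 D2]; split.
- by rewrite /derivable -E.
- by rewrite -D2 /derive -E.
- by rewrite /derivable E.
- by rewrite -D2 /derive E.
Qed.

Lemma is_derive_on_line b f p (t df : R) : is_derive (on_line b p t) (axis b) f df ->
  is_derive t 1 (fun t => f (on_line b p t)) df.
Proof.
move=> /is_derive_axisE; have -> : coordinate b (on_line b p t) = t by case: b.
by have -> : on_line b (on_line b p t) = on_line b p by apply/funext; case: b.
Qed.

Lemma schwarz f (fx fy fxy fyx : R * R -> R) p :
  (forall q, is_derive q (axis false) f (fx q)) ->
  (forall q, is_derive q (axis true) f (fy q)) ->
  (forall q, is_derive q (axis true) fx (fxy q)) ->
  (forall q, is_derive q (axis false) fy (fyx q)) ->
  continuous fxy -> continuous fyx -> fxy p = fyx p.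
Proof.
move=> dx dy dxy dyx cxy cyx; case: p => x y.
apply/eqP; rewrite -subr_eq0 -normr_le0; apply/ler_addgt0Pl => e e0; rewrite addr0.
have e2 : 0 < e / 2 by rewrite divr_gt0.
have /cvgrPdist_lt /(_ _ e2) /nbhs_ballP [d1 /= d10 B1] := cxy (x, y).
have /cvgrPdist_lt /(_ _ e2) /nbhs_ballP [d2 /= d20 B2] := cyx (x, y).
pose h := Num.min d1 d2 / 2; have h0 : 0 < h by rewrite divr_gt0// lt_min d10 d20.
have hm : h < Num.min d1 d2 by rewrite ltr_pdivrMr// ltr_pMr ?lt_min ?d10// ltr1n.
have {hm} [hd1 hd2] : h < d1 /\ h < d2 by move: hm; rewrite lt_min => /andP.
have near_corner d (c1 c2 : R) : h < d -> x < c1 < x + h -> y < c2 < y + h ->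
    ball (x, y) d (c1, c2).
  move=> hd I1 I2; split; rewrite /ball /= ltr_norml; lra.
(* The double increment over the square of side h at (x, y), expressed by the
   mean value theorem in the two possible orders. *)
have [c1 I1 E1] := @mean_value_step _ (fun z => f (z, y + h) - f (z, y))
  (fun z => fx (z, y + h) - fx (z, y)) x h h0 (fun z => is_deriveB
     (@is_derive_on_line false f (0, y + h) z _ (dx _))
     (@is_derive_on_line false f (0, y) z _ (dx _))).
have [c2 I2 E2] := @mean_value_step _ (fun z => fx (c1, z)) (fun z => fxy (c1, z)) y h h0
  (fun z => @is_derive_on_line true fx (c1, 0) z _ (dxy _)).
have [k2 J2 F2] := @mean_value_step _ (fun z => f (x + h, z) - f (x, z))
  (fun z => fy (x + h, z) - fy (x, z)) y h h0 (fun z => is_deriveB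
     (@is_derive_on_line true f (x + h, 0) z _ (dy _))
     (@is_derive_on_line true f (x, 0) z _ (dy _))).
have [k1 J1 F1] := @mean_value_step _ (fun z => fy (z, k2)) (fun z => fyx (z, k2)) x h h0
  (fun z => @is_derive_on_line false fy (0, k2) z _ (dyx _)).
have EF : fxy (c1, c2) = fyx (k1, k2).
  apply: (mulfI (lt0r_neq0 h0)); apply: (mulfI (lt0r_neq0 h0)).
  rewrite -E2 -F1 -E1 -F2; ring.
have := B1 _ (near_corner _ _ _ hd1 I1 I2); have := B2 _ (near_corner _ _ _ hd2 J1 J2).
rewrite /= EF !ltr_norml => /andP[u1 u2] /andP[w1 w2].
by rewrite ler_norml; lra.
Qed.

Lemma iter_partial_cat s s' u :
  iter_partial (s ++ s') u = iter_partial s (iter_partial s' u).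
Proof. by rewrite /iter_partial foldr_cat. Qed.

Lemma smooth_iter_partial s u : smooth u -> smooth (iter_partial s u).
Proof. by move=> su s'; rewrite -iter_partial_cat; exact: su. Qed.

Lemma is_derive_partial b u p : smooth u ->
  is_derive p (axis b) u (iter_partial [:: b] u p).
Proof. by move=> su; split => //; exact: (su [::]).2. Qed.

Lemma is_derive_iter_partial b s u p : smooth u ->
  is_derive p (axis b) (iter_partial s u) (iter_partial (b :: s) u p).
Proof. by move=> su; split => //; exact: (su s).2. Qed.

Lemma partialC b c u : smooth u ->
  iter_partial [:: b; c] u = iter_partial [:: c; b] u.
Proof.
move=> su.
have yx : iter_partial [:: true; false] u = iter_partial [:: false; true] u.
  apply/funext => p.
  apply: (@schwarz u (iter_partial [:: false] u) (iter_partial [:: true] u)).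
  - by move=> q; exact: is_derive_partial.
  - by move=> q; exact: is_derive_partial.
  - by move=> q; exact: (is_derive_iter_partial true [:: false] q su).
  - by move=> q; exact: (is_derive_iter_partial false [:: true] q su).
  - exact: (su [:: true; false]).1.
  - exact: (su [:: false; true]).1.
by case: b; case: c; [reflexivity|exact: yx|exact/esym/yx|reflexivity].
Qed.

Lemma partial_translate b u (T : R * R) : (forall p, u (p + T) = u p) ->
  forall p, iter_partial [:: b] u (p + T) = iter_partial [:: b] u p.
Proof.
move=> uT p.
have E : (fun h : R => h^-1 *: ((u \o shift (p + T)) (h *: axis b) - u (p + T))) =
         (fun h : R => h^-1 *: ((u \o shift p) (h *: axis b) - u p)).
  by apply/funext => h; rewrite /= /shift addrA !uT.
by rewrite /iter_partial /= /derive E.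
Qed.

Lemma torus_translate a u : fun_torus a u ->
  (forall p, u (p + (a, 0)) = u p) /\ (forall p, u (p + (0, a)) = u p).
Proof.
move=> [_ per]; split=> -[x y].
  by rewrite -[_ + _]/(x + a, y + 0) addr0 (per x y).1.
by rewrite -[_ + _]/(x + 0, y + a) addr0 (per x y).2.
Qed.

Lemma fun_torus_partial a b u : fun_torus a u -> fun_torus a (iter_partial [:: b] u).
Proof.
move=> uT; have [u1 u2] := torus_translate uT.
split=> [|x y]; first by apply: smooth_iter_partial; case: uT.
have -> : (x + a, y) = (x, y) + (a, 0) :> R * R.
  by rewrite -[RHS]/(x + a, y + 0) addr0.
have -> : (x, y + a) = (x, y) + (0, a) :> R * R.
  by rewrite -[RHS]/(x + 0, y + a) addr0.
by split; apply: partial_translate.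
Qed.

Lemma eigenspace_torus_partial a lam b u : eigenspace_in (fun_torus a) lam u ->
  eigenspace_in (fun_torus a) lam (iter_partial [:: b] u).
Proof.
move=> [uT eig]; split=> [|p]; first exact: fun_torus_partial.
have su : smooth u by case: uT.
have swap c : iter_partial [:: c; c; b] u = iter_partial [:: b; c; c] u.
  rewrite (iter_partial_cat [:: c] [:: c; b]) (partialC c b su) -iter_partial_cat.
  rewrite (iter_partial_cat [:: c; b] [:: c]) (partialC c b (smooth_iter_partial [:: c] su)).
  by rewrite -iter_partial_cat.
rewrite /laplacian -!iter_partial_cat -[[:: false; false] ++ _]/[:: false; false; b] -[[:: true; true] ++ _]/[:: true; true; b] !swap.
have dl : is_derive p (axis b) (laplacian u) (- (iter_partial [:: b; false; false] u p +
    iter_partial [:: b; true; true] u p)).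
  by apply: is_deriveN; apply: is_deriveD; exact: is_derive_iter_partial.
have dr : is_derive p (axis b) (laplacian u) (lam * iter_partial [:: b] u p).
  have -> : laplacian u = lam \*: u by apply/funext => q; rewrite eig.
  by apply: is_deriveZ; exact: is_derive_partial.
by rewrite -(@derive_val _ _ _ _ _ _ _ dl) (@derive_val _ _ _ _ _ _ _ dr).
Qed.

End Plane.

(** * A gradient estimate by the maximum principle *)

Section Gradient.
Context {R : realType}.
Implicit Types (u v f : R * R -> R) (p q : R * R) (b c : bool) (s : seq bool).

Lemma ball_on_line c p (z e : R) : `|z - coordinate c p| < e -> ball p e (on_line c p z).
Proof.
move=> ze; have e0 : 0 < e by exact: le_lt_trans ze.
by case: p c ze => [x y] [] /= ze; split; rewrite /ball /= ?subrr ?normr0// distrC.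
Qed.

(** At a maximum every second difference is nonpositive, while a positive and
    continuous second derivative would make small ones positive. *)
Lemma second_derivative_at_max f (f1 f2 : R * R -> R) c p :
  (forall q, is_derive q (axis c) f (f1 q)) ->
  (forall q, is_derive q (axis c) f1 (f2 q)) ->
  continuous f2 -> (forall q, f q <= f p) -> f2 p <= 0.
Proof.
move=> d1 d2 cf2 fmax; rewrite leNgt; apply/negP => f2p.
have /nbhs_ballP[e /= e0 B] : \forall q \near p, 0 < f2 q.
  exact: (cvgr_gt _ (cf2 p)).
have h0 : 0 < e / 2 by rewrite divr_gt0.
set x := coordinate c p.
have [z /andP[z1 z2] E] := @second_difference_mean_value _ (fun t => f (on_line c p t))
  (fun t => f1 (on_line c p t)) (fun t => f2 (on_line c p t)) x (e / 2) h0
  (fun t => is_derive_on_line (d1 _)) (fun t => is_derive_on_line (d2 _)).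
have : 0 < f2 (on_line c p z).
  by apply: B; apply: ball_on_line; rewrite ltr_norml -/x; lra.
have : second_difference (e / 2) (fun t => f (on_line c p t)) x <= 0.
  rewrite /second_difference /x on_line_coordinate.
  have := fmax (on_line c p (coordinate c p + e / 2)).
  have := fmax (on_line c p (coordinate c p - e / 2)).
  lra.
rewrite E pmulr_rle0 ?exprn_gt0// => le0 gt0.
by have := lt_le_trans gt0 le0; rewrite ltxx.
Qed.

Lemma doubly_periodic_max a f : 0 < a -> continuous f ->
  (forall x y, f (x + a, y) = f (x, y) /\ f (x, y + a) = f (x, y)) ->
  exists p, forall q, f q <= f p.
Proof.
move=> a0 cf per.
have cA : compact (`[0, a]%classic `*` `[0, a]%classic).
  by apply: compact_setX; exact: segment_compact.
have A0 : (`[0, a]%classic `*` `[0, a]%classic) !=set0.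
  by exists (0, 0); split; rewrite /= in_itv /= lexx ltW.
have [p _ fp] := compact_EVT_max A0 cA (continuous_subspaceT cf).
exists p => -[x y].
have [x' /andP[x'0 x'a] Ex] := periodic_shift_to x a0.
have [y' /andP[y'0 y'a] Ey] := periodic_shift_to y a0.
rewrite -(Ex (fun t => f (t, y)) (fun t => (per t y).1)).
rewrite -(Ey (fun t => f (x', t)) (fun t => (per x' t).2)).
by apply: fp; rewrite inE; split; rewrite /= in_itv /= ?x'0 ?y'0 ltW.
Qed.

(** Bernstein's method.  Put phi = v^2 + A u^2 with A = t + 1.  Since u and v are
    eigenfunctions with eigenvalue lam, half the (analyst's) Laplacian of phi is
    |grad v|^2 - lam v^2 + A (|grad u|^2 - lam u^2).  It is nonpositive where phi is
    maximal, and |grad u|^2 >= v^2, so (A - lam) v^2 <= A lam u^2 there; as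
    A - lam >= 1, this gives v^2 <= A t M^2 at the maximum, and therefore
    phi <= (A t + A) M^2 <= (t + 2)^2 M^2 everywhere.  The lemma is applied to
    v = du/dx and v = du/dy. *)
Lemma max_principle_bound a t lam M (u v : R * R -> R)
    (u1 u2 v1 v2 : bool -> R * R -> R) :
  0 < a -> 0 <= t -> lam <= t ->
  (forall c q, is_derive q (axis c) u (u1 c q)) ->
  (forall c q, is_derive q (axis c) (u1 c) (u2 c q)) ->
  (forall c q, is_derive q (axis c) v (v1 c q)) ->
  (forall c q, is_derive q (axis c) (v1 c) (v2 c q)) ->
  continuous u -> (forall c, continuous (u1 c)) -> (forall c, continuous (u2 c)) ->
  continuous v -> (forall c, continuous (v1 c)) -> (forall c, continuous (v2 c)) ->
  (forall x y, u (x + a, y) = u (x, y) /\ u (x, y + a) = u (x, y)) ->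
  (forall x y, v (x + a, y) = v (x, y) /\ v (x, y + a) = v (x, y)) ->
  (forall q, - (u2 false q + u2 true q) = lam * u q) ->
  (forall q, - (v2 false q + v2 true q) = lam * v q) ->
  (forall q, v q ^+ 2 <= u1 false q ^+ 2 + u1 true q ^+ 2) ->
  (forall q, `|u q| <= M) ->
  forall q, `|v q| <= M * (t + 2).
Proof.
move=> a0 t0 lt du du1 dv dv1 cu cu1 cu2 cv cv1 cv2 pu pv eu ev grad uM p.
have M0 : 0 <= M by rewrite (le_trans _ (uM p)).
pose A := t + 1; have A0 : 0 <= A by rewrite addr_ge0.
pose phi q := v q * v q + A * (u q * u q).
pose phi1 c q := (v q *: v1 c q + v q *: v1 c q) +
  A *: (u q *: u1 c q + u q *: u1 c q).
pose phi2 c q := ((v q *: v2 c q + v1 c q *: v1 c q) +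
                  (v q *: v2 c q + v1 c q *: v1 c q)) +
  A *: ((u q *: u2 c q + u1 c q *: u1 c q) + (u q *: u2 c q + u1 c q *: u1 c q)).
have d1 c q : is_derive q (axis c) phi (phi1 c q).
  have dvv := is_deriveM (dv c q) (dv c q); have duu := is_deriveM (du c q) (du c q).
  exact: (is_deriveD dvv (is_deriveZ A duu)).
have d2 c q : is_derive q (axis c) (phi1 c) (phi2 c q).
  have dvv := is_deriveM (dv c q) (dv1 c q); have duu := is_deriveM (du c q) (du1 c q).
  exact: (is_deriveD (is_deriveD dvv dvv) (is_deriveZ A (is_deriveD duu duu))).
have cM f g : continuous f -> continuous g -> continuous (fun q => f q * g q : R).
  by move=> cf cg q; apply: cvgM; [exact: cf|exact: cg].
have cD f g : continuous f -> continuous g -> continuous (fun q => f q + g q : R).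
  by move=> cf cg q; apply: cvgD; [exact: cf|exact: cg].
have cK : continuous (fun _ : R * R => A) by move=> q; exact: cvg_cst.
have cphi : continuous phi := cD _ _ (cM _ _ cv cv) (cM _ _ cK (cM _ _ cu cu)).
have cphi2 c : continuous (phi2 c).
  have cvv := cD _ _ (cM _ _ cv (cv2 c)) (cM _ _ (cv1 c) (cv1 c)).
  have cuu := cD _ _ (cM _ _ cu (cu2 c)) (cM _ _ (cu1 c) (cu1 c)).
  exact: (cD _ _ (cD _ _ cvv cvv) (cM _ _ cK (cD _ _ cuu cuu))).
have [p0 max0] : exists p0, forall q, phi q <= phi p0.
  apply: (@doubly_periodic_max a) => // x y.
  by rewrite /phi (pv x y).1 (pu x y).1 (pv x y).2 (pu x y).2.
have X := second_derivative_at_max (d1 false) (d2 false) (cphi2 false) max0.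
have Y := second_derivative_at_max (d1 true) (d2 true) (cphi2 true) max0.
have us : u p0 ^+ 2 <= M ^+ 2 by rewrite -real_normK ?num_real// ler_pXn2r// nnegrE.
have v0 : v p0 ^+ 2 <= A * t * M ^+ 2.
  have Xv : v p0 * v2 false p0 + v p0 * v2 true p0 = - lam * v p0 ^+ 2.
    rewrite expr2 -mulrDr -[_ + _]opprK ev; ring.
  have Xu : u p0 * u2 false p0 + u p0 * u2 true p0 = - lam * u p0 ^+ 2.
    rewrite expr2 -mulrDr -[_ + _]opprK eu; ring.
  have H : A * (u1 false p0 ^+ 2 + u1 true p0 ^+ 2
        + (u p0 * u2 false p0 + u p0 * u2 true p0)) + (v1 false p0 ^+ 2 + v1 true p0 ^+ 2)
        + (v p0 * v2 false p0 + v p0 * v2 true p0) <= 0.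
    by move: X Y; rewrite /phi2 /GRing.scale /=; lra.
  rewrite Xv Xu in H.
  have L0 := ler_wpM2l A0 (grad p0).
  have L1 : A * (v p0 ^+ 2 - lam * u p0 ^+ 2) <= lam * v p0 ^+ 2.
    by have := sqr_ge0 (v1 false p0); have := sqr_ge0 (v1 true p0); lra.
  have L2 : lam * v p0 ^+ 2 <= t * v p0 ^+ 2 by apply: ler_wpM2r => //; exact: sqr_ge0.
  have L3 : A * (lam * u p0 ^+ 2) <= A * (t * M ^+ 2).
    apply: ler_wpM2l => //; apply: (@le_trans _ _ (t * u p0 ^+ 2)).
      by apply: ler_wpM2r => //; exact: sqr_ge0.
    by apply: ler_wpM2l.
  by move: L1 L2 L3; rewrite /A; lra.
have le : v p ^+ 2 + A * u p ^+ 2 <= v p0 ^+ 2 + A * u p0 ^+ 2 := max0 p.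
have t2 : 0 <= t + 2 by lra.
rewrite -(@ler_pXn2r _ 2) ?nnegrE ?(mulr_ge0 M0 t2)// real_normK ?num_real//.
have L1 := ler_wpM2l A0 us.
have L2 : 0 <= A * u p ^+ 2 by rewrite mulr_ge0 ?sqr_ge0.
have L3 : 0 <= t * M ^+ 2 by rewrite mulr_ge0 ?sqr_ge0.
have L4 := sqr_ge0 M.
move: le v0 L1 L2; rewrite /A => le v0 L1 L2.
have -> : (M * (t + 2)) ^+ 2 =
  (t + 1) * t * M ^+ 2 + (t + 1) * M ^+ 2 + 2 * (t * M ^+ 2) + 3 * M ^+ 2 by ring.
lra.
Qed.

Lemma gradient_bound a t lam M b u : 0 < a -> 0 <= t -> lam <= t ->
  eigenspace_in (fun_torus a) lam u -> (forall p, `|u p| <= M) ->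
  forall p, `|iter_partial [:: b] u p| <= M * (t + 2).
Proof.
move=> a0 t0 lt eu uM.
have [[su pu] eigu] := eu.
have [[sv pv] eigv] := eigenspace_torus_partial b eu.
apply: (@max_principle_bound a t lam M u (iter_partial [:: b] u)
  (fun c => iter_partial [:: c] u) (fun c => iter_partial [:: c; c] u)
  (fun c => iter_partial [:: c] (iter_partial [:: b] u))
  (fun c => iter_partial [:: c; c] (iter_partial [:: b] u)) a0 t0 lt) => //.
- by move=> c q; exact: is_derive_partial.
- by move=> c q; exact: is_derive_iter_partial.
- by move=> c q; exact: is_derive_partial.
- by move=> c q; exact: is_derive_iter_partial.
- exact: (su [::]).1.
- by move=> c; exact: (su [:: c]).1.
- by move=> c; exact: (su [:: c; c]).1.
- exact: (sv [::]).1.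
- by move=> c; exact: (sv [:: c]).1.
- by move=> c; exact: (sv [:: c; c]).1.
- by move=> q; case: (b); rewrite ?lerDr ?lerDl sqr_ge0.
Qed.

End Gradient.

(** * Expansion of eigenfunctions into modes *)

Section Expansion.
Context {R : realType}.
Implicit Types (u v f : R * R -> R) (p q : R * R) (b c : bool) (s : seq bool) (a t lam M : R).

(** In each variable, a kind (true for sine, false for cosine) and a frequency. *)
Definition mode_index K := ((bool * 'I_K) * (bool * 'I_K))%type.

Definition plane_mode a K (i : mode_index K) p : R :=
  mode a i.1.1 i.1.2 p.1 * mode a i.2.1 i.2.2 p.2.

Lemma iter_partial_pure_bound a t lam M b u n : 0 < a -> 0 <= t -> lam <= t ->
  eigenspace_in (fun_torus a) lam u -> (forall p, `|u p| <= M) ->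
  eigenspace_in (fun_torus a) lam (iter_partial (nseq n b) u) /\
  forall p, `|iter_partial (nseq n b) u p| <= M * (t + 2) ^+ n.
Proof.
move=> a0 t0 lt eu uM; elim: n => [|n [en bn]].
  by split=> // p; rewrite expr0 mulr1.
rewrite -[nseq n.+1 b]/([:: b] ++ nseq n b) iter_partial_cat; split.
  exact: eigenspace_torus_partial.
by move=> p; rewrite exprSr mulrA; exact: (@gradient_bound _ a t lam).
Qed.

Lemma eigenfunction_bounded a lam u : 0 < a -> eigenspace_in (fun_torus a) lam u ->
  exists M, forall p, `|u p| <= M.
Proof.
move=> a0 [[su pu] _].
have [p0 max0] : exists p0, forall p, `|u p| <= `|u p0|.
  apply: (@doubly_periodic_max _ a) => // [p|x y].
    by apply: cvg_norm; exact: (su [::]).1.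
  by rewrite (pu x y).1 (pu x y).2.
by exists `|u p0|.
Qed.

Lemma line_sampling_formula a t lam b u L p : 0 < a -> 0 <= t -> lam <= t ->
  eigenspace_in (fun_torus a) lam u -> a * (t + 2) < L.+1%:R ->
  u p = \sum_(m < L.+1) \sum_(c : bool)
    dirichlet_weight m * mode a c m (coordinate b p) *
    grid_mean a L.*2.+1 (fun y => mode a c m y * u (on_line b p y)).
Proof.
move=> a0 t0 lt eu aL; have [M uM] := eigenfunction_bounded a0 eu.
pose G n y := iter_partial (nseq n b) u (on_line b p y).
have [[su pu] _] := eu.
have tG : bounded_tower (t + 2) M G.
  move=> n x; split; last exact: (iter_partial_pure_bound b n a0 t0 lt eu uM).2.
  by apply: is_derive_on_line; exact: is_derive_iter_partial.
have pG : periodic (G 0) a.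
  by move=> x; rewrite /G /= /on_line; case: (b); rewrite ?(pu _ _).1 ?(pu _ _).2.
have t2 : 0 <= t + 2 by rewrite addr_ge0.
have := sampling_formula a0 t2 tG pG aL (coordinate b p).
by rewrite /G /= on_line_coordinate.
Qed.

(** The coefficients of the expansion along x are combinations of the functions
    u (x_j, .) at finitely many x_j, each of which is expanded along y. *)
Lemma eigenfunction_expansion a t lam u L : 0 < a -> 0 <= t -> lam <= t ->
  eigenspace_in (fun_torus a) lam u -> a * (t + 2) < L.+1%:R ->
  exists c : mode_index L.+1 -> R, forall p, u p = \sum_i c i * plane_mode a i p.
Proof.
move=> a0 t0 lt eu aL.
pose W (i : bool * 'I_L.+1) y := dirichlet_weight i.2 * mode a i.1 i.2 y : R.
pose C (i1 i2 : bool * 'I_L.+1) := grid_mean a L.*2.+1 (fun x => mode a i1.1 i1.2 x *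
  grid_mean a L.*2.+1 (fun y => mode a i2.1 i2.2 y * u (x, y))).
have flat (F : bool * 'I_L.+1 -> R) :
    \sum_(m < L.+1) \sum_(c : bool) F (c, m) = \sum_i F i.
  by rewrite exchange_big pair_bigA; apply: eq_bigr => -[].
have onex x y : u (x, y) = \sum_i W i x *
    grid_mean a L.*2.+1 (fun x => mode a i.1 i.2 x * u (x, y)).
  by rewrite (line_sampling_formula false (x, y) a0 t0 lt eu aL) -flat.
have ony x y : u (x, y) = \sum_i W i y *
    grid_mean a L.*2.+1 (fun y => mode a i.1 i.2 y * u (x, y)).
  by rewrite (line_sampling_formula true (x, y) a0 t0 lt eu aL) -flat.
exists (fun i : mode_index L.+1 => dirichlet_weight i.1.2 * dirichlet_weight i.2.2 * C i.1 i.2).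
move=> [x y]; rewrite onex.
transitivity (\sum_i1 \sum_i2 W i1 x * (W i2 y * C i1 i2)).
  apply: eq_bigr => i1 _; rewrite -mulr_sumr; congr (_ * _).
  under [RHS]eq_bigr do rewrite -grid_meanZ.
  rewrite -grid_mean_sum; apply: eq_grid_mean => x'.
  rewrite ony mulr_sumr; apply: eq_bigr => i2 _; ring.
rewrite pair_bigA; apply: eq_bigr => -[i1 i2] _ /=.
by rewrite /W /plane_mode /=; ring.
Qed.

(** The second difference of the constant 1 is 0, so the mean of a mode is killed
    by the nonzero factor 4 sin^2 (pi d / N). *)
Lemma grid_mean_mode0 a N b d : 0 < a -> (0 < d < N)%N -> grid_mean a N (mode a b d) = 0.
Proof.
move=> a0 /andP[d0 dN]; have N0 : (0 < N)%N by apply: leq_ltn_trans dN.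
have NR : 0 < N%:R :> R by rewrite ltr0n.
have p1 : periodic (fun _ : R => 1 : R) a by [].
have := grid_mean_second_difference b d a0 N0 p1.
rewrite (@eq_grid_mean _ _ _ _ (fun=> 0)); last first.
  by move=> x; rewrite /second_difference; ring.
rewrite (@eq_grid_mean _ _ _ (fun x => mode a b d x * 1) (mode a b d)); last first.
  by move=> x; rewrite mulr1.
rewrite {1}/grid_mean big1// mulr0 => /esym/eqP; rewrite mulf_eq0 => /orP[|/eqP//].
rewrite -oppr_eq0 opprB freq_step// two_sub_two_cos mulf_eq0 pnatr_eq0/= sqrf_eq0.
suff /lt0r_neq0/negbTE -> : 0 < sin (pi * d%:R / N%:R) :> R by [].
apply: sin_gt0_pi; rewrite divr_gt0 ?mulr_gt0 ?pi_gt0 ?ltr0n//=.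
by rewrite ltr_pdivrMr// ltr_pM2l ?pi_gt0// ltr_nat.
Qed.

Lemma grid_mean_cst a N (k : R) : (0 < N)%N -> grid_mean a N (fun=> k) = k.
Proof.
move=> N0; rewrite /grid_mean sumr_const card_ord -[k *+ N]mulr_natl mulKf//.
by rewrite pnatr_eq0 -lt0n.
Qed.

Lemma grid_mean_cos a N d : 0 < a -> (d < N)%N ->
  grid_mean a N (mode a false d) = (d == 0)%:R.
Proof.
move=> a0 dN; case: d dN => [|d] dN; last by rewrite grid_mean_mode0.
rewrite (@eq_grid_mean _ _ _ _ (fun=> 1)) ?grid_mean_cst// => x.
by rewrite /mode /freq mulr0 mul0r cos0.
Qed.

Lemma grid_mean_sin a N d : 0 < a -> (d < N)%N -> grid_mean a N (mode a true d) = 0.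
Proof.
move=> a0 dN; case: d dN => [|d] dN; last by rewrite grid_mean_mode0.
rewrite (@eq_grid_mean _ _ _ _ (fun=> 0)) ?grid_mean_cst// => x.
by rewrite /mode /freq mulr0 mul0r sin0.
Qed.

(** The members of the family that are not identically zero: the sine of
    frequency 0 is excluded. *)
Definition nontrivial_mode K (i : bool * 'I_K) := i.1 ==> (0 < i.2)%N.

(** Products of modes are half sums of modes with frequencies m + k and m - k,
    and both frequencies are below N. *)
Lemma mode_orthogonality a N K (i j : bool * 'I_K) : 0 < a -> (K.*2 <= N)%N ->
  nontrivial_mode i -> nontrivial_mode j ->
  grid_mean a N (fun x => mode a i.1 i.2 x * mode a j.1 j.2 x) =
  (i == j)%:R / dirichlet_weight i.2.
Proof.
move=> a0 KN; wlog ij : i j / (j.2 <= i.2)%N.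
  move=> H vi vj; have [ji|/ltnW ij] := leqP j.2 i.2; first exact: H.
  rewrite (@eq_grid_mean _ _ _ _ (fun x => mode a j.1 j.2 x * mode a i.1 i.2 x)).
    rewrite H// eq_sym; case: eqP => [->//|_]; by rewrite !mul0r.
  by move=> x; rewrite mulrC.
case: i j ij => [b m] [c k] /= km; rewrite /nontrivial_mode /= => vm vk.
have dN : (m - k < N)%N by have := ltn_ord m; lia.
have sN : (m + k < N)%N by have := ltn_ord m; have := ltn_ord k; lia.
have E : (m == k) = (m - k == 0)%N.
  by apply/eqP/eqP => [->|]; [rewrite subnn|move=> mk0; apply: val_inj => /=; lia].
(* The signs in the product formulas of trigonometry. *)
pose s1 : R := if b && c then -1 else 1.
pose s2 : R := if ~~ b && c then -1 else 1.
rewrite (@eq_grid_mean _ _ _ _ (fun x => 2^-1 * (s1 * mode a (b (+) c) (m + k) x +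
    s2 * mode a (b (+) c) (m - k) x))); last first.
  move=> x; rewrite /mode !(freqE a (_ + _)) !(freqE a (_ - _)) !(freqE a m) !(freqE a k).
  rewrite natrD natrB//.
  have -> : (m%:R + k%:R) * freq a 1 * x = m%:R * freq a 1 * x + k%:R * freq a 1 * x by ring.
  have -> : (m%:R - k%:R) * freq a 1 * x = m%:R * freq a 1 * x - k%:R * freq a 1 * x by ring.
  by rewrite /s1 /s2; case: b {vm s1 s2}; case: c {vk};
    rewrite /= ?(sinD, cosD, sinN, cosN); field.
rewrite grid_meanZ grid_meanD !grid_meanZ xpair_eqE.
rewrite /s1 /s2; case: b vm {s1 s2}; case: c vk => /= vk vm;
  rewrite ?grid_mean_cos ?grid_mean_sin// ?(mulr0, addr0, mul0r)// E.
- rewrite (_ : (m + k == 0)%N = false) ?mulr0 ?add0r ?mul1r; last by lia.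
  by case: (nat_of_ord m) vm => //= n _; rewrite mulrC.
- rewrite !mul1r; case: (nat_of_ord m) km => [|n] km /=.
    by case: (nat_of_ord k) km => //= _; field.
  by rewrite add0r mulrC.
Qed.

End Expansion.

(** * Modes as linearly independent eigenfunctions *)

Section PlaneModes.
Context {R : realType}.
Implicit Types (u v f : R * R -> R) (p q : R * R) (b : bool) (s : seq bool) (a t lam : R) (K : nat).

Lemma mode_independent a K (d : bool * 'I_K -> R) : 0 < a ->
  (forall i, ~~ nontrivial_mode i -> d i = 0) ->
  (forall x, \sum_i d i * mode a i.1 i.2 x = 0) -> forall i, d i = 0.
Proof.
move=> a0 d0 sd j; have [vj|/d0//] := boolP (nontrivial_mode j).
have Kj : (0 < K)%N by apply: leq_trans (ltn_ord j.2).
have : grid_mean a K.*2 (fun x => \sum_i d i * (mode a i.1 i.2 x * mode a j.1 j.2 x)) = 0.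
  rewrite (@eq_grid_mean _ _ _ _ (fun=> 0)) ?grid_mean_cst ?double_gt0// => x.
  by under eq_bigr do rewrite mulrA; rewrite -mulr_suml sd mul0r.
rewrite grid_mean_sum (bigD1 j)//= big1 ?addr0 => [|i ij].
  rewrite grid_meanZ mode_orthogonality// eqxx mul1r => /eqP; rewrite mulf_eq0 invr_eq0.
  by case: (nat_of_ord j.2) => [|n]; rewrite /= ?oner_eq0 ?pnatr_eq0 ?orbF => /eqP.
rewrite grid_meanZ; have [vi|/d0->] := boolP (nontrivial_mode i); last by rewrite mul0r.
by rewrite mode_orthogonality// (negbTE ij) mul0r mulr0.
Qed.

Definition nontrivial K (i : mode_index K) := nontrivial_mode i.1 && nontrivial_mode i.2.

Lemma plane_mode_trivial a K (i : mode_index K) : ~~ nontrivial i -> plane_mode a i =1 fun=> 0.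
Proof.
have M0 (j : bool * 'I_K) x : ~~ nontrivial_mode j -> mode a j.1 j.2 x = 0 :> R.
  rewrite /nontrivial_mode /mode negb_imply -eqn0Ngt => /andP[-> /eqP->].
  by rewrite /freq mulr0 mul0r sin0.
by rewrite negb_and => /orP[] /M0 E p; rewrite /plane_mode E ?mul0r ?mulr0.
Qed.

Lemma plane_mode_independent a K (c : mode_index K -> R) : 0 < a ->
  (forall i, ~~ nontrivial i -> c i = 0) ->
  (forall p, \sum_i c i * plane_mode a i p = 0) -> forall i, c i = 0.
Proof.
move=> a0 c0 sc [i1 i2].
apply: (@mode_independent a K (fun i2 => c (i1, i2))) => // [j vj|y].
  by apply: c0; rewrite /nontrivial /= (negbTE vj) andbF.
apply: (@mode_independent a K (fun i1 => \sum_i2 c (i1, i2) * mode a i2.1 i2.2 y)) => //.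
  move=> j vj; rewrite big1// => k _.
  by rewrite c0 ?mul0r// /nontrivial /= (negbTE vj).
move=> x; rewrite -[RHS](sc (x, y)) [RHS](eq_bigr (fun i : mode_index K =>
    c (i.1, i.2) * (mode a i.1.1 i.1.2 x * mode a i.2.1 i.2.2 y))) => [|[]//].
rewrite -(pair_bigA _ (fun i1 i2 : bool * 'I_K =>
    c (i1, i2) * (mode a i1.1 i1.2 x * mode a i2.1 i2.2 y))) /=.
apply: eq_bigr => j _; rewrite mulr_suml; apply: eq_bigr => k _; ring.
Qed.

(** The class of products of shifted cosines is closed under both partial
    derivatives, as differentiating a cosine shifts its phase by pi / 2. *)
Definition wave (k al x0 be y0 : R) p : R :=
  k * (cos (al * p.1 + x0) * cos (be * p.2 + y0)).

Lemma is_derive_wave b k al x0 be y0 p :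
  is_derive p (axis b) (wave k al x0 be y0)
    (if b then wave (k * be) al x0 be (y0 + pi / 2) p
     else wave (k * al) al (x0 + pi / 2) be y0 p).
Proof.
have dcos (w z x : R) : is_derive x 1 (fun x => cos (w * x + z))
    (w * cos (w * x + (z + pi / 2))).
  have dl : is_derive x 1 (fun x => w * x + z) (w *: (1 : R) + 0).
    by apply: is_deriveD.
  have := @is_derive1_comp R (@cos R) (fun x => w * x + z) x _ _
     (is_derive_cos _) dl.
  by rewrite addrA cosDpihalf /GRing.scale /= addr0 mulr1 mulrC.
apply/is_derive_axisE; case: b; rewrite /wave /=.
  have := is_deriveZ (k * cos (al * p.1 + x0)) (dcos be y0 p.2).
  rewrite /GRing.scale /= => D.
  rewrite [X in is_derive _ _ X _](_ : _ = (fun x => k * cos (al * p.1 + x0) * cos (be * x + y0))).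
    by apply: (is_derive_eq D); ring.
  by apply/funext => x; rewrite mulrA.
have := is_deriveZ (k * cos (be * p.2 + y0)) (dcos al x0 p.1).
rewrite /GRing.scale /= => D.
rewrite [X in is_derive _ _ X _](_ : _ = (fun x => k * cos (be * p.2 + y0) * cos (al * x + x0))).
  by apply: (is_derive_eq D); ring.
by apply/funext => x; ring.
Qed.

Lemma partial_wave b k al x0 be y0 :
  iter_partial [:: b] (wave k al x0 be y0) =
    if b then wave (k * be) al x0 be (y0 + pi / 2)
    else wave (k * al) al (x0 + pi / 2) be y0.
Proof.
apply/funext => p; have := @derive_val _ _ _ _ _ _ _ (is_derive_wave b k al x0 be y0 p).
by case: b.
Qed.

Lemma iter_partial_wave s k al x0 be y0 : exists k' x0' y0',
  iter_partial s (wave k al x0 be y0) = wave k' al x0' be y0'.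
Proof.
elim: s => [|b s [k' [x' [y' IH]]]]; first by exists k, x0, y0.
rewrite -[b :: s]/([:: b] ++ s) iter_partial_cat IH partial_wave.
by case: b; do 3 eexists; reflexivity.
Qed.

Lemma smooth_wave k al x0 be y0 : smooth (wave k al x0 be y0).
Proof.
move=> s; have [k' [x' [y' ->]]] := iter_partial_wave s k al x0 be y0; split.
  move=> p; apply: cvgM; first exact: cvg_cst.
  apply: cvgM.
    apply: (@cvg_comp _ _ _ (fun p : R * R => al * p.1 + x') (@cos R)
      _ (nbhs (al * p.1 + x'))); last exact: continuous_cos.
    apply: cvgD; last exact: cvg_cst.
    by apply: cvgM; [exact: cvg_cst|exact: cvg_fst].
  apply: (@cvg_comp _ _ _ (fun p : R * R => be * p.2 + y') (@cos R)
      _ (nbhs (be * p.2 + y'))); last exact: continuous_cos.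
  apply: cvgD; last exact: cvg_cst.
  by apply: cvgM; [exact: cvg_cst|exact: cvg_snd].
by move=> b p; exact: (@ex_derive _ _ _ _ _ _ _ (is_derive_wave b k' al x' be y' p)).
Qed.

Lemma laplacian_wave k al x0 be y0 p :
  laplacian (wave k al x0 be y0) p = (al ^+ 2 + be ^+ 2) * wave k al x0 be y0 p.
Proof.
rewrite /laplacian (iter_partial_cat [:: false] [:: false]) (iter_partial_cat [:: true] [:: true]).
have cospi2 (x y : R) : cos (x + (y + pi / 2 + pi / 2)) = - cos (x + y).
  by rewrite -addrA -splitr addrA cosDpi.
by rewrite !partial_wave /wave !cospi2; ring.
Qed.

Lemma plane_mode_wave a K (i : mode_index K) :
  plane_mode a i = wave 1 (freq a i.1.2) (if i.1.1 then - (pi / 2) else 0)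
                          (freq a i.2.2) (if i.2.1 then - (pi / 2) else 0).
Proof.
apply/funext => p; rewrite /plane_mode /wave /mode mul1r.
by case: i.1.1; case: i.2.1; rewrite ?cosBpihalf ?addr0.
Qed.

Definition mode_eigenvalue a K (i : mode_index K) : R := freq a i.1.2 ^+ 2 + freq a i.2.2 ^+ 2.

Lemma eigenspace_plane_mode a K (i : mode_index K) : 0 < a ->
  eigenspace_in (fun_torus a) (mode_eigenvalue a i) (plane_mode a i).
Proof.
move=> a0; split; last by move=> p; rewrite plane_mode_wave laplacian_wave.
split; first by rewrite plane_mode_wave; exact: smooth_wave.
by move=> x y; rewrite /plane_mode /= !mode_periodic.
Qed.

Lemma iter_partial_sum (I : Type) (r : seq I) (c : I -> R) (F : I -> R * R -> R) s :
  (forall i, smooth (F i)) ->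
  iter_partial s (fun p => \sum_(i <- r) c i * F i p) =
  fun p => \sum_(i <- r) c i * iter_partial s (F i) p.
Proof.
move=> sF; elim: s => // b s IH.
rewrite -[b :: s]/([:: b] ++ s) iter_partial_cat IH; apply/funext => p.
suff D : is_derive p (axis b) (fun q => \sum_(i <- r) c i * iter_partial s (F i) q)
    (\sum_(i <- r) c i * iter_partial (b :: s) (F i) p).
  exact: (@derive_val _ _ _ _ _ _ _ D).
elim: r {IH} => [|i r IH].
  rewrite big_nil (_ : (fun _ => _) = cst 0) ?big_nil; first exact: is_derive_cst.
  by apply/funext => q; rewrite big_nil.
rewrite big_cons (_ : (fun _ => _) = (fun q => c i * iter_partial s (F i) q +
   \sum_(j <- r) c j * iter_partial s (F j) q)); last first.
  by apply/funext => q; rewrite big_cons.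
have Di := is_derive_iter_partial b s p (sF i).
exact: (is_deriveD (is_deriveZ (c i) Di) IH).
Qed.

(** Applying the Laplacian to the expansion multiplies each coefficient by the
    eigenvalue of its mode, so linear independence kills those with a different
    eigenvalue. *)
Lemma eigenfunction_modes a t lam u L : 0 < a -> 0 <= t -> lam <= t ->
  eigenspace_in (fun_torus a) lam u -> a * (t + 2) < L.+1%:R ->
  exists c : mode_index L.+1 -> R,
    (forall i, c i != 0 -> nontrivial i /\ mode_eigenvalue a i = lam) /\
    forall p, u p = \sum_i c i * plane_mode a i p.
Proof.
move=> a0 t0 lt eu aL.
have [c0 E0] := eigenfunction_expansion a0 t0 lt eu aL.
pose c i := if nontrivial i then c0 i else 0.
have E p : u p = \sum_i c i * plane_mode a i p.
  rewrite E0; apply: eq_bigr => i _; rewrite /c.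
  by case: ifPn => // /(plane_mode_trivial a) ->; rewrite !mulr0.
exists c; split=> // i ci.
have vi : nontrivial i by move: ci; rewrite /c; case: ifP => //; rewrite eqxx.
split=> //; apply/eqP; rewrite -subr_eq0.
suff /eqP : (mode_eigenvalue a i - lam) * c i = 0.
  by rewrite mulf_eq0 (negbTE ci) orbF.
apply: (@plane_mode_independent a _ (fun i => (mode_eigenvalue a i - lam) * c i)) => //.
  by move=> j vj; rewrite /c (negbTE vj) mulr0.
move=> p; have sm (j : mode_index L.+1) : smooth (plane_mode a j) by rewrite plane_mode_wave; exact: smooth_wave.
have uE : u = fun p => \sum_i c i * plane_mode a i p by apply/funext.
have := eu.2 p; rewrite /laplacian {1 2}uE !iter_partial_sum// E.
rewrite -big_split /= => H.
rewrite (eq_bigr (fun j => - (c j * iter_partial [:: false; false] (plane_mode a j) p +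
    c j * iter_partial [:: true; true] (plane_mode a j) p) -
    lam * (c j * plane_mode a j p))) => [|j _].
  by rewrite sumrB sumrN H -mulr_sumr subrr.
have := (eigenspace_plane_mode j a0).2 p; rewrite /laplacian => Ej.
by rewrite -mulrDr mulrBl mulrBl mulrAC -Ej mulNr [X in - X]mulrC mulrA.
Qed.

End PlaneModes.

(** * Dimensions and the counting function *)

Section Counting.
Context {R : realType}.
Implicit Types (S : set (R * R -> R)) (a t lam : R) (K n : nat).

Lemma fun_dim_span S n (g : 'I_n -> R * R -> R) :
  (forall i, S (g i)) -> lin_indep g ->
  (forall u, S u -> exists c : 'I_n -> R, forall p, u p = \sum_(i < n) c i * g i p) ->
  fun_dim S = (n%:R)%:E.
Proof.
move=> Sg ig span; apply/eqP; rewrite eq_le; apply/andP; split; last first.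
  by apply: ereal_sup_ubound; exists n => //; exists g.
apply: ge_ereal_sup => _ [k [f [Sf indf]] <-]; rewrite lee_fin ler_nat leqNgt.
(* More than n functions in the span of n: their coordinate matrix has a
   nonzero row in its kernel, which is a linear relation. *)
apply/negP => nk.
have [A EA] : exists A : 'M[R]_(k, n), forall i p, f i p = \sum_(j < n) A i j * g j p.
  have /choice [c Ec] i := span (f i) (Sf i).
  by exists (\matrix_(i, j) c i j) => i p; rewrite Ec; apply: eq_bigr => j _; rewrite mxE.
have : kermx A != 0.
  rewrite -mxrank_eq0 mxrank_ker -lt0n subn_gt0.
  by apply: leq_ltn_trans nk; exact: rank_leq_col.
case/rowV0Pn => v /sub_kermxP vA /negP; apply; apply/eqP/rowP => i; rewrite mxE.
apply: (indf (fun i => v 0 i)) => p.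
under eq_bigr do rewrite EA mulr_sumr.
rewrite exchange_big big1// => j _.
have := congr1 (fun B : 'rV_n => B 0 j) vA; rewrite !mxE => vAj.
by under eq_bigr do rewrite mulrA; rewrite -mulr_suml vAj mul0r.
Qed.

(** The common part of the two counts: if the modes selected by [I] belong to [S]
    and span its eigenspaces, the multiplicity of lam is the number of selected
    modes with eigenvalue lam, and the counting function groups the selected modes
    by eigenvalue. *)
Lemma counting_modes a t S K (I : pred (mode_index K)) : 0 < a ->
  (forall i, I i -> nontrivial i /\ S (plane_mode a i)) ->
  (forall lam u, lam <= t -> eigenspace_in S lam u ->
     exists c : mode_index K -> R, (forall i, c i != 0 -> I i /\ mode_eigenvalue a i = lam) /\
       forall p, u p = \sum_i c i * plane_mode a i p) ->
  Defs.counting S t = (#|[pred i | I i && (mode_eigenvalue a i <= t)]|%:R)%:E.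
Proof.
move=> a0 IS exp.
have eigI i : I i -> eigenspace_in S (mode_eigenvalue a i) (plane_mode a i).
  move=> Ii; split; first exact: (IS i Ii).2.
  exact: (eigenspace_plane_mode i a0).2.
pose B lam := [pred i : mode_index K | I i && (mode_eigenvalue a i == lam)].
have dim lam : lam <= t -> fun_dim (eigenspace_in S lam) = (#|B lam|%:R)%:E.
  move=> lt; apply: (@fun_dim_span _ _ (fun k => plane_mode a (enum_val k : mode_index K))).
  - move=> k; have := enum_valP k; move: (enum_val k) => i.
    by rewrite inE => /andP[Ik /eqP <-]; exact: eigI.
  - move=> c c0 k.
    pose c' (i : mode_index K) := \sum_(j < #|B lam|) c j * (enum_val j == i)%:R.
    have c'E j : c' (enum_val j) = c j.
      rewrite /c' (bigD1 j)//= eqxx mulr1 big1 ?addr0// => l lj.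
      by rewrite (inj_eq enum_val_inj) (negbTE lj) mulr0.
    rewrite -c'E; apply: (@plane_mode_independent _ a) => // [i vi|p].
      rewrite /c' big1// => j _; case: eqP => [E|_]; last by rewrite mulr0.
      have := enum_valP j; rewrite inE E => /andP[Ii _].
      by rewrite (IS i Ii).1 in vi.
    rewrite -[RHS](c0 p); under eq_bigr do rewrite mulr_suml.
    rewrite exchange_big; apply: eq_bigr => j _.
    rewrite (bigD1 (enum_val j))//= eqxx mulr1 big1 ?addr0// => l lj.
    by rewrite eq_sym (negbTE lj) mulr0 mul0r.
  - move=> u /(exp _ _ lt) [c [c0 E]]; exists (fun k => c (enum_val k)) => p.
    rewrite E -(big_enum_val (fun i : mode_index K => c i * plane_mode a i p)) [RHS]big_mkcond.
    apply: eq_bigr => i _; case: ifPn => // iB; have [->|ci] := eqVneq (c i) 0.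
      by rewrite mul0r.
    by have [Ii Ei] := c0 i ci; rewrite inE Ii Ei eqxx in iB.
have ev lam : lam <= t -> eigenvalue_in S lam <-> exists2 i, I i & mode_eigenvalue a i = lam.
  move=> lt; split=> [[u /(exp _ _ lt) [c [c0 E]] [p up]]|[i Ii <-]].
    have [//|noI] := pselect (exists2 i, I i & mode_eigenvalue a i = lam).
    move: up; rewrite E big1 ?eqxx// => i _; have [->|ci] := eqVneq (c i) 0.
      by rewrite mul0r.
    by have [Ii Ei] := c0 i ci; case: noI; exists i.
  exists (plane_mode a i); first exact: eigI.
  have [//|nop] := pselect (exists p, plane_mode a i p != 0).
  have := @plane_mode_independent R a K (fun j => (j == i)%:R) a0.
  move=> /(_ _ _ i)/eqP; rewrite eqxx oner_eq0 => H; exfalso; apply: notF; apply: H.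
    by move=> j vj; case: eqP vj => // ->; rewrite (IS i Ii).1.
  move=> p; rewrite (bigD1 i)//= eqxx mul1r big1 ?addr0 => [|j /negbTE->].
    by apply/eqP/negPn/negP => np; case: nop; exists p.
  by rewrite mul0r.
pose s := undup [seq mode_eigenvalue a i | i <- enum [pred i : mode_index K | I i && (mode_eigenvalue a i <= t)]].
have mems lam : (lam \in s) = `[< eigenvalue_in S lam /\ lam <= t >].
  rewrite mem_undup; apply/mapP/asboolP => [[i]|[e lt]].
    rewrite mem_enum inE => /andP[Ii it ->]; split=> //; apply/ev => //.
    by exists i.
  have /ev := e; move=> /(_ lt)[i Ii E]; exists i => //.
  by rewrite mem_enum inE Ii E.
rewrite /Defs.counting (_ : [set lam | _] = [set` s]); last first.
  by apply/seteqP; split=> lam /=; rewrite mems => /asboolP.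
rewrite esum_fset; [|exact: finite_seq|]; last first.
  move=> lam; rewrite inE /= mems => /asboolP [_ lt].
  by rewrite dim// lee_fin ler0n.
rewrite -fsbig_seq ?undup_uniq//.
rewrite (eq_big_seq (fun lam => (#|B lam|%:R)%:E)); last first.
  by move=> lam; rewrite mems => /asboolP [_ lt]; rewrite dim.
rewrite sumEFin -natr_sum; congr (_%:R)%:E.
under eq_bigr do rewrite -sum1_card big_mkcond.
rewrite exchange_big -sum1_card [RHS]big_mkcond; apply: eq_bigr => i _ /=.
rewrite !inE; have [Ii|nI] := boolP (I i); last by rewrite big1// => lam _; rewrite inE (negbTE nI).
have [it|ti] := boolP (mode_eigenvalue a i <= t).
  rewrite (bigD1_seq (mode_eigenvalue a i)) ?undup_uniq//=; last first.
    by rewrite mem_undup; apply: map_f; rewrite mem_enum inE Ii.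
  rewrite inE Ii eqxx big1 ?addn0// => lam ne.
  by rewrite inE Ii eq_sym (negbTE ne).
rewrite big1_seq// => lam /=; rewrite mems => /asboolP[_ lt]; rewrite ?inE ?Ii /=.
by case: eqP => // E; rewrite E lt in ti.
Qed.

End Counting.

(** * Modes on the projective plane *)

Section ProjectivePlane.
Context {R : realType}.
Implicit Types (u : R * R -> R) (a t lam : R) (K m n : nat) (b : bool).

(** The nontrivial modes of side 2 that are fixed by both glide reflections
    defining the projective plane: translating by half a period multiplies a mode
    of frequency m by (-1)^m, and reflecting changes the sign of sines. *)
Definition glide_invariant K (i : mode_index K) :=
  [&& nontrivial i, i.1.1 == odd (i.1.2 + i.2.2) & i.2.1 == odd (i.1.2 + i.2.2)].

Lemma mode2_translate b m x : mode 2 b m (x + 1) = (-1) ^+ m * mode 2 b m x :> R.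
Proof.
have E : freq 2 m * (x + 1) = freq 2 m * x + pi *+ m.
  by rewrite /freq -(mulr_natr pi m); field.
by case: b; rewrite /mode E; [exact: (alternatingn (@sinDpi R))|exact: (alternatingn (@cosDpi R))].
Qed.

Lemma mode_opp a b m x : mode a b m (- x) = (-1) ^+ b * mode a b m x :> R.
Proof. by case: b; rewrite /mode mulrN ?sinN ?cosN ?mulN1r ?mul1r. Qed.

Lemma plane_mode2_glide K (i : mode_index K) x y :
  plane_mode 2 i (1 - x, y + 1) = (-1) ^+ (i.1.1 + (i.1.2 + i.2.2)) * plane_mode 2 i (x, y) :> R
  /\
  plane_mode 2 i (x + 1, 1 - y) = (-1) ^+ (i.2.1 + (i.1.2 + i.2.2)) * plane_mode 2 i (x, y) :> R.
Proof.
rewrite /plane_mode /= [1 - x]addrC [1 - y]addrC !mode2_translate !mode_opp !exprD.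
by split; ring.
Qed.

Lemma sign_fixed (e : nat) (c : R) : ((-1) ^+ e - 1) * c = 0 -> c != 0 -> ~~ odd e.
Proof.
move=> /eqP; rewrite mulf_eq0 => /orP[|/eqP->]; last by rewrite eqxx.
by rewrite -signr_odd; case: odd => //=; rewrite expr1 => /eqP H; exfalso; lra.
Qed.

(** The square of each glide reflection is a translation by 2. *)
Lemma fun_PP_torus u : fun_PP u -> fun_torus 2 u.
Proof.
move=> [su pu]; split=> // x y; split.
  rewrite -(pu x y).2 -(pu (x + 1) (1 - y)).2; congr (u (_, _)); ring.
rewrite -(pu x y).1 -(pu (1 - x) (y + 1)).1; congr (u (_, _)); ring.
Qed.

Lemma fun_PP_plane_mode K (i : mode_index K) : glide_invariant i -> fun_PP (plane_mode 2 i : R * R -> R).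
Proof.
move=> /and3P[_ /eqP e1 /eqP e2]; split; first by rewrite plane_mode_wave; exact: smooth_wave.
have ev (b : bool) n : b = odd n -> (-1) ^+ (b + n) = 1 :> R.
  by move=> ->; rewrite -signr_odd oddD oddb addbb.
by move=> x y; have [-> ->] := plane_mode2_glide i x y; rewrite !ev ?mul1r.
Qed.

(** An invariant eigenfunction is a combination of modes, and composing it with a
    glide reflection multiplies each coefficient by the sign of its mode; so the
    modes of sign -1 have coefficient 0. *)
Lemma eigenfunction_projective_modes t lam u L : 0 <= t -> lam <= t ->
  eigenspace_in fun_PP lam u -> 2 * (t + 2) < L.+1%:R ->
  exists c : mode_index L.+1 -> R,
    (forall i, c i != 0 -> glide_invariant i /\ mode_eigenvalue 2 i = lam) /\
    forall p, u p = \sum_i c i * plane_mode 2 i p.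
Proof.
move=> t0 lt [PPu eu] tL; have a0 : 0 < 2 :> R by [].
have [c [c0 E]] := eigenfunction_modes a0 t0 lt (conj (fun_PP_torus PPu) eu) tL.
exists c; split=> // i ci; have [vi mi] := c0 i ci; split=> //.
have fixed (e : mode_index L.+1 -> nat) (T : R * R -> R * R) :
    (forall j p, plane_mode 2 j (T p) = (-1) ^+ e j * plane_mode 2 j p :> R) ->
    (forall p, u (T p) = u p) -> ~~ odd (e i).
  move=> He uT; apply: sign_fixed ci.
  apply: (@plane_mode_independent R 2 _ (fun j => ((-1) ^+ e j - 1) * c j)) => //.
    move=> j vj; have [->|/c0[]] := eqVneq (c j) 0; first by rewrite mulr0.
    by rewrite (negbTE vj).
  move=> p; have := uT p; rewrite !E => /eqP; rewrite -subr_eq0 -sumrB => /eqP H.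
  rewrite -[RHS]H; apply: eq_bigr => j _; rewrite He; ring.
have o1 := fixed (fun j => j.1.1 + (j.1.2 + j.2.2))%N (fun p => (1 - p.1, p.2 + 1)).
have o2 := fixed (fun j => j.2.1 + (j.1.2 + j.2.2))%N (fun p => (p.1 + 1, 1 - p.2)).
have {}o1 := o1 (fun j p => (plane_mode2_glide j p.1 p.2).1) _.
rewrite /glide_invariant vi /=; apply/andP; split.
  have : ~~ odd (i.1.1 + (i.1.2 + i.2.2)).
    by apply: o1 => -[x y]; exact: (PPu.2 x y).1.
  by rewrite oddD oddb negb_add.
have : ~~ odd (i.2.1 + (i.1.2 + i.2.2)).
  apply: o2 => [j [x y]|[x y]]; first exact: (plane_mode2_glide j x y).2.
  exact: (PPu.2 x y).2.
by rewrite oddD oddb negb_add.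
Qed.

Lemma alternating_prefix_sum (Q : pred nat) n : (forall m, Q m.+1 -> Q m) ->
  \sum_(m < n) (-1) ^+ m.+1 * (Q m)%:R = 0 :> R \/
  \sum_(m < n) (-1) ^+ m.+1 * (Q m)%:R = -1 :> R.
Proof.
move=> dQ; have all k : (forall m, (m < k)%N -> Q m) ->
    \sum_(m < k) (-1) ^+ m.+1 * (Q m)%:R = - (odd k)%:R :> R.
  elim: k => [|k IH] Qk; first by rewrite big_ord0 oppr0.
  rewrite big_ord_recr /= IH => [|m mk]; last by apply: Qk; exact: ltnW.
  by rewrite Qk// mulr1 -signr_odd /=; case: odd; rewrite /= ?expr0 ?expr1; ring.
elim: n => [|n IH]; first by rewrite big_ord0; left.
have [Qn|nQ] := boolP (Q n); last first.
  by rewrite big_ord_recr /= (negbTE nQ) mulr0 addr0.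
have Qm m : (m <= n)%N -> Q m.
  move=> /subnKC; move: (n - m)%N => d; elim: d m => [|d IHd] m.
    by rewrite addn0 => ->.
  by rewrite addnS -addSn => /IHd /dQ.
by rewrite all//; case: odd; [right|left]; rewrite ?oppr0.
Qed.

Lemma sum_mode_index K (F : mode_index K -> R) : \sum_i F i =
  \sum_(m < K) \sum_(n < K) \sum_(b : bool) \sum_(c : bool) F ((b, m), (c, n)).
Proof.
have flat (G : bool * 'I_K -> R) : \sum_i G i = \sum_(m < K) \sum_(b : bool) G (b, m).
  by rewrite [RHS]exchange_big pair_bigA; apply: eq_bigr => -[].
rewrite (eq_bigr (fun i : mode_index K => F (i.1, i.2))) => [|[]//].
rewrite -(pair_bigA _ (fun i1 i2 => F (i1, i2))) flat; apply: eq_bigr => m _ /=.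
under eq_bigr do rewrite flat.
by rewrite exchange_big.
Qed.

(** Frequencies m, n > 0 carry four modes on the torus and exactly one invariant
    mode: the product of cosines if m + n is even, of sines if it is odd.  On an
    axis, the frequency m > 0 carries two modes, and one invariant mode if m is
    even and none otherwise.  So 4 X - T is 3 + 4 S with S the alternating sum of
    [alternating_prefix_sum]. *)
Lemma projective_count K (P : rel nat) : (0 < K)%N -> P 0 0 ->
  symmetric P -> (forall m, P m.+1 0 -> P m 0) ->
  let X : R := #|[pred i : mode_index K | glide_invariant i && P i.1.2 i.2.2]|%:R in
  let T : R := #|[pred i : mode_index K | nontrivial i && P i.1.2 i.2.2]|%:R in
  X - 4^-1 * T - 4^-1 = - 2^-1 \/ X - 4^-1 * T - 4^-1 = 2^-1.
Proof.
move=> K0 P00 sP dP X T.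
have cardE (Q : pred (mode_index K)) :
    #|[pred i : mode_index K | Q i && P i.1.2 i.2.2]|%:R = \sum_i (Q i)%:R * (P i.1.2 i.2.2)%:R :> R.
  rewrite -sum1_card natr_sum big_mkcond /=; apply: eq_bigr => i _.
  by rewrite inE; case: (Q i); case: (P _ _); rewrite ?mul1r ?mul0r.
have sgn k : (-1) ^+ k = 1 - 2 * (odd k)%:R :> R.
  by rewrite -signr_odd; case: odd; rewrite /= ?expr0 ?expr1; ring.
(* D m n is the contribution to 4 X - T of the modes of frequencies (m, n). *)
pose D m n : R := if m is m'.+1 then (if n is _.+1 then 0 else 2 * (-1) ^+ m)
  else (if n is n'.+1 then 2 * (-1) ^+ n else 3).
have XT : 4 * X - T = \sum_(m < K) \sum_(n < K) D m n * (P m n)%:R.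
  rewrite /X /T !cardE mulr_sumr -sumrB sum_mode_index.
  apply: eq_bigr => m _; apply: eq_bigr => n _; rewrite !big_bool /=.
  rewrite /glide_invariant /nontrivial /nontrivial_mode /= /D !sgn.
  move: (nat_of_ord m) (nat_of_ord n) (P m n)%:R => m' n' r.
  case: m' => [|m']; case: n' => [|n'] /=; rewrite ?add0n ?addn0 /=.
  - by ring.
  - by case: (odd n') => /=; ring.
  - by case: (odd m') => /=; ring.
  - by case: (odd (m' + n'.+1)) => /=; ring.
have [S [SE S01]] : exists S : R, 4 * X - T = 3 + 4 * S /\ (S = 0 \/ S = -1).
  case: K K0 @X @T cardE XT => // K _ X T _ ->.
  exists (\sum_(m < K) (-1) ^+ m.+1 * (P m.+1 0)%:R); split; last first.
    by apply: (@alternating_prefix_sum (fun m => P m.+1 0)) => m /dP.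
  rewrite big_ord_recl big_ord_recl /= P00 mulr1 -addrA; congr (_ + _).
  have -> : 4 = 2 + 2 :> R by ring.
  rewrite mulrDl; congr (_ + _).
    by rewrite mulr_sumr; apply: eq_bigr => m _; rewrite mulrA sP.
  rewrite mulr_sumr; apply: eq_bigr => m _.
  rewrite big_ord_recl /= big1 ?addr0 ?mulrA// => n _; by rewrite mul0r.
by case: S01 SE => -> SE; [right|left]; lra.
Qed.

End ProjectivePlane.

(** * Comparison of the counting functions *)

Section TorusCount.
Context {R : realType}.
Implicit Types (a t : R) (L K : nat).

Lemma N_torus_modes a t L : 0 < a -> 0 <= t -> a * (t + 2) < L.+1%:R ->
  N_torus a t =
  (#|[pred i : mode_index L.+1 | nontrivial i && (mode_eigenvalue a i <= t)]|%:R)%:E.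
Proof.
move=> a0 t0 aL; apply: counting_modes => // [i vi|lam u lt eu].
  by split=> //; case: (eigenspace_plane_mode i a0).
exact: (eigenfunction_modes a0 t0 lt eu aL).
Qed.

Lemma N_PP_modes t L : 0 <= t -> 2 * (t + 2) < L.+1%:R ->
  N_PP t =
  (#|[pred i : mode_index L.+1 | glide_invariant i && (mode_eigenvalue 2 i <= t)]|%:R)%:E.
Proof.
move=> t0 tL; apply: counting_modes => // [i vi|lam u lt eu].
  by split; [case/and3P: vi|exact: fun_PP_plane_mode].
exact: (eigenfunction_projective_modes t0 lt eu tL).
Qed.

Lemma mode_eigenvalue_rescale K (i : mode_index K) :
  mode_eigenvalue 1 i = 4 * mode_eigenvalue 2 i :> R.
Proof. by rewrite /mode_eigenvalue /freq; field. Qed.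

End TorusCount.

Local Open Scope ereal_scope.

Theorem mainTheorem4 (R : realType) (t : R) (t_ge0 : (0 <= t)%R) :
  N_torus 2%R t = N_torus 1%R (4 * t)%R /\
  (N_PP t - (4^-1)%:E * N_torus 2%R t - (4^-1)%:E = (- 2^-1)%:E \/
   N_PP t - (4^-1)%:E * N_torus 2%R t - (4^-1)%:E = (2^-1)%:E).
Proof.
(* One range of frequencies is used for the three counting functions. *)
pose L := Num.truncn (4 * t + 4)%R.
have tL : (4 * t + 4 < L.+1%:R)%R.
  by have /andP[] := @truncn_itv R (4 * t + 4)%R ltac:(lra).
have t2L : (2 * (t + 2) < L.+1%:R)%R by lra.
have t1L : (1 * (4 * t + 2) < L.+1%:R)%R by lra.
rewrite (@N_torus_modes R 2%R t L)// (@N_PP_modes R t L)//.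
split.
  rewrite (@N_torus_modes R 1%R (4 * t)%R L)//; last by rewrite mulr_ge0.
  congr (_%:R)%:E; apply: eq_card => i; rewrite !inE mode_eigenvalue_rescale.
  by rewrite ler_pM2l.
rewrite -EFinM -!EFinB.
pose P m n := (freq 2 m ^+ 2 + freq 2 n ^+ 2 <= t :> R)%R.
have [||m n|m|E|E] := @projective_count R L.+1 P.
- by [].
- by rewrite /P /freq !mulr0 expr0n addr0.
- by rewrite /P addrC.
- rewrite /P => le; apply: le_trans le; rewrite lerD2r ler_pXn2r ?nnegrE//.
  + by rewrite ler_wpM2l ?ler_nat// divr_ge0// mulr_ge0// pi_ge0.
  + by rewrite mulr_ge0// divr_ge0// mulr_ge0// pi_ge0.
  + by rewrite mulr_ge0// divr_ge0// mulr_ge0// pi_ge0.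
- by left; congr _%:E; exact: E.
- by right; congr _%:E; exact: E.
Qed.
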